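(* Let $N\ge 1$ be an integer, let $p,q,r>0$ be real numbers satisfying $\frac1p+\frac1q=1+\frac1r$, and let $f\in L^p(\mathbb{R}^N)$ and $g\in L^q(\mathbb{R}^N)$ be non-negative functions. (1) If $p,q,r\ge 1$, then $$\|f*g\|_r\le \Bigl(\frac{C_pC_q}{C_r}\Bigr)^N\|f\|_p\,\|g\|_q .$$ (2) If $p,q,r\le 1$, then $$\|f*g\|_r\ge \Bigl(\frac{C_pC_q}{C_r}\Bigr)^N\|f\|_p\,\|g\|_q .$$
   Context: For $t>0$, $t\ne 1$, the conjugate exponent $t'$ is defined by $\frac1t+\frac1{t'}=1$ (so $t'<0$ when $t<1$), and $$C_t=\sqrt{\frac{t^{1/t}}{|t'|^{1/t'}}}.$$ For $t=1$ one has $t'=\infty$, $1/t'=0$, and by the limiting convention $C_1=1$. For every $p>0$ (including $0<p<1$) and measurable $f\ge 0$ on $\mathbb{R}^N$, $\|f\|_p=\bigl(\int_{\mathbb{R}^N} f^p\bigr)^{1/p}\in[0,\infty]$, and $f\in L^p(\mathbb{R}^N)$ means $\|f\|_p<\infty$. The convolution of non-negative functions is $(f*g)(x)=\int_{\mathbb{R}^N} f(x-y)g(y)\,dy\in[0,\infty]$. Integrals are with respect to Lebesgue measure. *)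

(* Defs.v *)
From HB Require Import structures.
From mathcomp Require Import all_boot all_order all_algebra.
From mathcomp Require Import all_classical all_reals all_analysis.

Set Implicit Arguments.
Unset Strict Implicit.
Unset Printing Implicit Defensive.
Import Order.TTheory GRing.Theory Num.Theory.
Import numFieldNormedType.Exports.

Local Open Scope classical_set_scope.
Local Open Scope ring_scope.

Section cons_measure.
Local Open Scope ereal_scope.
Context {R : realType} (n : nat).
Local Notation T := (measurableTypeR R).

Definition tcons (z : T * n.-tuple T) : n.+1.-tuple T :=
  [the n.+1.-tuple T of z.1 :: z.2].

Lemma measurable_tcons : measurable_fun [set: T * n.-tuple T] tcons.
Proof. exact: measurable_cons measurable_fst measurable_snd. Qed.

Lemma tcons_preimage (A : set (T * n.-tuple T)) :
  tcons @^-1` ((fun x => (thead x, [tuple of behead x])) @^-1` A) = A.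
Proof.
rewrite /preimage; apply/seteqP; split => -[a t] /=.
  by rewrite theadE (_ : [tuple of _] = t)//; apply/val_inj.
by rewrite theadE (_ : [tuple of _] = t)//; apply/val_inj.
Qed.

Variable m : {sigma_finite_measure set (n.-tuple T) -> \bar R}.

Definition cons_measure : set (n.+1.-tuple T) -> \bar R :=
  pushforward (@lebesgue_measure R \x m) tcons.

Let cons_measure0 : cons_measure set0 = 0.
Proof. by rewrite /cons_measure /pushforward preimage_set0 measure0. Qed.

Let cons_measure_ge0 A : 0 <= cons_measure A.
Proof. by rewrite /cons_measure /pushforward; exact: measure_ge0. Qed.

Let cons_measure_sigma_additive : semi_sigma_additive cons_measure.
Proof.
move=> F mF tF mUF; rewrite /cons_measure /pushforward preimage_bigcup.
apply: measure_semi_sigma_additive.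
- by move=> k; rewrite -[X in measurable X]setTI; exact: measurable_tcons.
- apply/trivIsetP => /= i j _ _ ij; rewrite -preimage_setI.
  by move/trivIsetP : tF => /(_ _ _ _ _ ij) ->//; rewrite preimage_set0.
- by rewrite -preimage_bigcup -[X in measurable X]setTI; exact: measurable_tcons.
Qed.

HB.instance Definition _ := isMeasure.Build _ _ _ cons_measure
  cons_measure0 cons_measure_ge0 cons_measure_sigma_additive.

Let cons_measure_sigma_finite : sigma_finite setT cons_measure.
Proof.
have /sigma_finiteP[F [TF ndF Foo]] := sigma_finiteT (@lebesgue_measure R).
have /sigma_finiteP[G [TG ndG Goo]] := sigma_finiteT m.
pose u (x : n.+1.-tuple T) : T * n.-tuple T := (thead x, [tuple of behead x]).
have mu : measurable_fun setT u.
  apply/measurable_fun_pairP; split => /=.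
    exact: measurable_tnth.
  exact: measurable_behead.
exists (fun k => u @^-1` (F k `*` G k)).
  rewrite -preimage_bigcup (_ : \bigcup_k _ = setT) ?preimage_setT//.
  rewrite -setXTT TF TG predeqE => -[x y]; split.
    by move=> [k _ []/= ? ?]; split; exists k.
  move=> [/= [k _ Fkx] [l _ Gly]]; exists (maxn k l) => //; split.
  - by move: x Fkx; exact/subsetPset/ndF/leq_maxl.
  - by move: y Gly; exact/subsetPset/ndG/leq_maxr.
move=> k; have [? ?] := Foo k; have [? ?] := Goo k; split.
  by rewrite -[X in measurable X]setTI; apply: mu => //; exact: measurableX.
rewrite /cons_measure /pushforward tcons_preimage product_measure1E//.
by rewrite lte_mul_pinfty// ge0_fin_numE.
Qed.

HB.instance Definition _ := Measure_isSigmaFinite.Build _ _ _ cons_measure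
  cons_measure_sigma_finite.

End cons_measure.

Section lebesgue_tuple.
Context (R : realType).
Local Notation T := (measurableTypeR R).

(* N-fold product of the one-dimensional Lebesgue measure, on the Borel
   (product) sigma-algebra of [n.-tuple R]; see [borel_lebesgue_box]. *)
Fixpoint borel_lebesgue (n : nat) :
    {sigma_finite_measure set (n.-tuple T) -> \bar R} :=
  match n with
  | 0 => [the {sigma_finite_measure set (0.-tuple T) -> \bar R} of
           dirac [tuple]]
  | n.+1 => [the {sigma_finite_measure set (n.+1.-tuple T) -> \bar R} of
              cons_measure (borel_lebesgue n)]
  end.

Lemma measurable_box (n : nat) (A : 'I_n -> set T) :
  (forall i, measurable (A i)) ->
  measurable [set x : n.-tuple T | forall i, A i (tnth x i)].
Proof.
move=> mA; rewrite (_ : [set _ | _] =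
    \bigcap_(i in [set: 'I_n]) ((@tnth n T)^~ i @^-1` A i)).
  apply: fin_bigcap_measurable => // i _.
  by rewrite -[X in measurable X]setTI; apply: measurable_tnth.
by apply/seteqP; split => x /= xA i; [move=> _|]; exact: xA.
Qed.

Lemma borel_lebesgue_box (n : nat) (A : 'I_n -> set T) :
  (forall i, measurable (A i)) ->
  borel_lebesgue n [set x | forall i, A i (tnth x i)] =
  (\prod_(i < n) lebesgue_measure (A i))%E.
Proof.
elim: n A => [|n IH] A mA.
  by rewrite big_ord0 /= diracE mem_set// => -[].
have mB := measurable_box (fun i => mA (lift ord0 i)).
rewrite big_ord_recl -IH// -product_measure1E//.
rewrite /= /cons_measure /pushforward; congr (product_measure1 _ _ _).
apply/seteqP; split => -[a t] /= => [H|[H0 H] i].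
  split; first by have := H ord0; rewrite tnth0.
  by move=> i; have := H (lift ord0 i); rewrite tnthS.
have [j ->|->] := unliftP ord0 i; first by rewrite tnthS.
by rewrite tnth0.
Qed.

End lebesgue_tuple.

(* [euclidean R N] is [N.-tuple R] equipped with its Lebesgue sigma-algebra,
   i.e. the Caratheodory sigma-algebra of the outer measure induced by
   [borel_lebesgue]; [lebesgueN] is the (complete) Lebesgue measure on it. *)
Definition euclidean (R : realType) (N : nat) :=
  caratheodory_type ((borel_lebesgue R N)^*)%mu.

HB.instance Definition _ (R : realType) (N : nat) :=
  Measurable.on (euclidean R N).

Definition lebesgueN (R : realType) (N : nat) : set (euclidean R N) -> \bar R :=
  @completed_measure_extension _ _ _ (borel_lebesgue R N).

HB.instance Definition _ (R : realType) (N : nat) :=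
  Measure.on (@lebesgueN R N).

Lemma lebesgueN_box (R : realType) (N : nat)
    (A : 'I_N -> set (measurableTypeR R)) : (forall i, measurable (A i)) ->
  lebesgueN [set x | forall i, A i (tnth x i)] =
  (\prod_(i < N) lebesgue_measure (A i))%E.
Proof.
move=> mA; rewrite -borel_lebesgue_box//.
apply: (@measurable_mu_extE _ _ _ (borel_lebesgue R N)).
exact: measurable_box.
Qed.

Arguments lebesgueN R N : clear implicits.

Definition vsub (R : realType) (N : nat) (x y : euclidean R N) :
  euclidean R N := [tuple tnth x i - tnth y i | i < N].

Definition convolution (R : realType) (N : nat) (f g : euclidean R N -> R) :
    euclidean R N -> \bar R :=
  fun x => (\int[lebesgueN R N]_y (f (vsub x y) * g y)%:E)%E.

(* [sqrt (t^(1/t) / |t'|^(1/t'))] where [1/t + 1/t' = 1]; [t' < 0] if [t < 1],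
   and [t' = +oo] if [t = 1], where the value is the limit [1]. *)
Definition young_const (R : realType) (t : R) : R :=
  if t == 1 then 1 else
  let t' := fine (hoelder_conjugate t%:E) in
  Num.sqrt ((t `^ t^-1) / (`|t'| `^ t'^-1)).

(* Main.v *)
From HB Require Import structures.
Require Import Defs.
From mathcomp Require Import all_boot all_order all_algebra.
From mathcomp Require Import all_classical all_reals all_analysis.
From mathcomp Require Import measurable_realfun ring lra.
Import Order.TTheory GRing.Theory Num.Theory.
Import numFieldNormedType.Exports.

Set Implicit Arguments.
Unset Strict Implicit.
Unset Printing Implicit Defensive.
Local Open Scope classical_set_scope.
Local Open Scope ring_scope.

(* Barthe's transport argument. In dimension one, put [m = (1 - 1/p)/(1 - 1/r)]
   and [n = (1 - 1/q)/(1 - 1/r)], so that [m + n = 1], and let [S], [U] be the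
   increasing maps with [F = f(S)^p S'] and [G = g(U)^q U'], where [F] and [G]
   are multiples of the Gaussians [exp(- p n x^2)] and [exp(- q m x^2)]. Write
   [w = f * g]. The change of variables [x = S(m P - Q) + U(Q + n P)],
   [y = U(Q + n P)] turns the integral of [w^r] into that of
   [f(S) g(U) S' U' w(x)^(r-1)]. For fixed [Q], [dx/dP = m S' + n U'] is at
   least [S'^m U'^n], and Young's inequality for products (its reverse if
   [r < 1]) bounds the integrand by a Gaussian, whose integral is explicit, and
   a multiple of [w(x)^r dx/dP], whose integral in [P] is that of [w^r] again.
   Regularization and truncation extend this to all Borel functions, and the
   cases where an exponent is [1] are Minkowski's integral inequality.
   Splitting off one coordinate and applying Minkowski's integral inequality
   (reversed if [r <= 1]) gives the inequality in every dimension. *)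

(** The transport estimate contains the integral [omega] of [w^r] on both sides: it compares [omega]
    with [omega^(1 - 1/r)] times a constant, and the conclusion comes from cancelling a power of
    [omega]. This forces [0 < omega < +oo], hence the preliminary case of positive continuous
    functions below a Gaussian. The sharp constant is reached because the weight in Young's
    inequality for products is optimised separately for each [Q]. For [r < 1] the coefficient
    [1 - 1/r] is negative, and the term that carries it, being finite, is moved to the other side.
    The second obstacle is measurability. Splitting off coordinates with Tonelli takes place on the
    product sigma-algebra of tuples, whereas the statement concerns its completion, so [f] and [g]
    are replaced by Borel functions equal to them almost everywhere. In the induction on the
    dimension the norms of slices may be infinite, which is why the one-dimensional inequality is
    proved for functions with values in [\bar R]. *)

Section transport.
Local Open Scope ereal_scope.
Context d1 d2 (X : measurableType d1) (Y : measurableType d2) (R : realType).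
Variables (mu : {measure set X -> \bar R}) (nu : {measure set Y -> \bar R}).
Variables (S : X -> Y) (h : X -> R).
Hypothesis mS : measurable_fun [set: X] S.
Hypothesis mh : measurable_fun [set: X] h.
Hypothesis h0 : forall x, (0 <= h x)%R.
Hypothesis nuE : forall A, measurable A ->
  nu A = \int[mu]_x ((\1_A (S x) * h x)%:E).

Import HBNNSimple.

(** The hypothesis [nuE] is this formula for indicators; linearity extends it to simple functions
    and monotone convergence to [f]. *)
Lemma ge0_integral_transport (f : Y -> \bar R) :
  measurable_fun [set: Y] f -> (forall y, 0 <= f y) ->
  \int[nu]_y f y = \int[mu]_x (f (S x) * (h x)%:E).
Proof.
move=> mf f0; pose f_ := nnsfun_approx measurableT mf.
have mI A : measurable A -> measurable_fun [set: X] (fun x => \1_A (S x) : R).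
  move=> mA; apply: (@measurableT_comp _ _ _ _ _ _ (\1_A : Y -> R)) => //.
transitivity (limn (fun n => \int[nu]_y (f_ n y)%:E)).
  rewrite -monotone_convergence//.
  - apply: eq_integral => y _; apply/esym/cvg_lim => //.
    exact: cvg_nnsfun_approx.
  - by move=> n; exact/measurable_EFinP.
  - by move=> n y _; rewrite lee_fin.
  - by move=> y _ m n mn; rewrite lee_fin; exact/lefP/nd_nnsfun_approx.
have mfS n : measurable_fun [set: X] (fun x => (f_ n (S x) * h x)%R).
  apply: measurable_funM => //; apply: (@measurableT_comp _ _ _ _ _ _ (f_ n)) => //.
have -> : (fun n => \int[nu]_y (f_ n y)%:E) =
    (fun n => \int[mu]_x (f_ n (S x) * h x)%:E).
  apply/funext => n.
  under eq_integral do rewrite fimfunE -fsumEFin//.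
  rewrite ge0_integral_fsum//; last 2 first.
  - by move=> y; exact/measurable_EFinP/measurable_funM.
  - by move=> y x _; rewrite nnfun_muleindic_ge0.
  transitivity (\sum_(k \in range (f_ n))
      \int[mu]_x (k * (\1_(f_ n @^-1` [set k]) (S x) * h x))%:E).
    apply: eq_fsbigr => k /[!inE] -[y _ <-].
    rewrite integralZl_indic_nnsfun// integral_indic// setIT nuE//.
    under [RHS]eq_integral do rewrite EFinM.
    rewrite ge0_integralZl//.
    - apply/measurable_EFinP/measurable_funM => //; exact: mI.
    - by move=> x _; rewrite lee_fin mulr_ge0.
    - by rewrite lee_fin.
  rewrite -ge0_integral_fsum//.
  - apply: eq_integral => x _; rewrite fsumEFin//; congr EFin.
    rewrite [in RHS](fimfunE (f_ n)) mulrC mulr_fsumr.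
    by apply: eq_fsbigr => k _; rewrite [RHS]mulrC mulrA.
  - move=> k; apply/measurable_EFinP/measurable_funM => //.
    apply: measurable_funM => //; exact: mI.
  - move=> k x _; rewrite lee_fin mulrA mulr_ge0//.
    by have := nnfun_muleindic_ge0 (f_ n) k (S x); rewrite lee_fin.
rewrite -monotone_convergence//.
- apply: eq_integral => x _.
  under eq_fun do rewrite EFinM.
  apply/cvg_lim => //; apply: cvgeZr => //.
  exact: cvg_nnsfun_approx.
- by move=> n; exact/measurable_EFinP.
- by move=> n x _; rewrite lee_fin mulr_ge0.
- move=> x _ m n mn; rewrite lee_fin ler_wpM2r//.
  exact/lefP/nd_nnsfun_approx.
Qed.

End transport.

(** * Powers and norms of functions valued in [\bar R], and Hoelder's inequality *)

Definition pnorm d (T : measurableType d) (R : realType)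
    (mu : {measure set T -> \bar R}) (r : R) (f : T -> \bar R) : \bar R :=
  ((\int[mu]_x (f x `^ r)) `^ r^-1)%E.

Section pnorm.
Local Open Scope ereal_scope.
Context d (T : measurableType d) (R : realType).
Variable mu : {measure set T -> \bar R}.
Implicit Types (f g : T -> \bar R) (p q r : R).

Lemma measurable_poweR_comp f r : measurable_fun [set: T] f ->
  measurable_fun [set: T] (fun x => f x `^ r).
Proof.
by move=> mf; exact: (measurableT_comp (measurable_poweR _)).
Qed.

Lemma pnorm_ge0 r f : 0 <= pnorm mu r f.
Proof. exact: poweR_ge0. Qed.

Lemma Lnorm_pnorm r f : (forall x, 0 <= f x) -> 'N[mu]_r%:E[f] = pnorm mu r f.
Proof.
move=> f0; rewrite unlock /pnorm; congr (_ `^ _).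
by apply: eq_integral => x _; rewrite gee0_abs.
Qed.

Lemma poweR_pnorm r f : r != 0%R -> pnorm mu r f `^ r = \int[mu]_x (f x `^ r).
Proof.
move=> r0; rewrite /pnorm -poweRrM mulVf// poweRe1//.
by apply: integral_ge0 => x _; exact: poweR_ge0.
Qed.

Lemma pnorm1 f : (forall x, 0 <= f x) -> pnorm mu 1 f = \int[mu]_x f x.
Proof.
move=> f0; rewrite /pnorm invr1 poweRe1; last first.
  by apply: integral_ge0 => x _; exact: poweR_ge0.
by apply: eq_integral => x _; rewrite poweRe1.
Qed.

Lemma le_poweR r (x y : \bar R) : (0 <= r)%R -> 0 <= x -> x <= y -> x `^ r <= y `^ r.
Proof.
move=> r0 x0 xy; apply: gt0_ler_poweR => //; rewrite in_itv/= leey andbT//.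
exact: le_trans xy.
Qed.

Lemma pnorm_le r f g : (0 < r)%R ->
  measurable_fun [set: T] f -> measurable_fun [set: T] g ->
  (forall x, 0 <= f x) -> (forall x, f x <= g x) -> pnorm mu r f <= pnorm mu r g.
Proof.
move=> r0 mf mg f0 fg.
apply: le_poweR; rewrite ?invr_ge0 ?(ltW r0)//.
  by apply: integral_ge0 => x _; exact: poweR_ge0.
apply: ge0_le_integral => //.
- by move=> x _; exact: poweR_ge0.
- exact: measurable_poweR_comp.
- exact: measurable_poweR_comp.
- by move=> x _; apply: le_poweR; rewrite ?(ltW r0).
Qed.

Lemma pnorm_eq0_ae r f : (0 < r)%R -> measurable_fun [set: T] f ->
  (forall x, 0 <= f x) -> pnorm mu r f = 0 -> {ae mu, forall x, f x = 0}.
Proof.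
move=> r0 mf f0; rewrite -Lnorm_pnorm// => f_0.
by have := Lnorm_eq0_eq0 mf _ f_0; rewrite lte_fin => /(_ r0); apply: filterS => x /(_ I).
Qed.

Lemma pnorm_fin_ae r f : (0 < r)%R -> measurable_fun [set: T] f ->
  (forall x, 0 <= f x) -> pnorm mu r f < +oo -> {ae mu, forall x, f x \is a fin_num}.
Proof.
move=> r0 mf f0 foo.
have : mu.-integrable [set: T] (fun x => f x `^ r).
  apply/integrableP; split; first exact: measurable_poweR_comp.
  under eq_integral do rewrite gee0_abs ?poweR_ge0//.
  by apply: lty_poweRy foo; rewrite gt_eqF// invr_gt0.
move/integrable_ae => /(_ measurableT); apply: filterS => x /(_ I).
rewrite ge0_fin_numE ?poweR_ge0// ge0_fin_numE//.
by move/lty_poweRy; apply; rewrite gt_eqF.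
Qed.

(** Reduction to the real-valued [hoelder]. If a norm is [0], the integrand vanishes almost
    everywhere, which settles the products [0 * +oo]; if one norm is infinite and the other
    positive, the bound is [+oo]; otherwise [f] and [g] are finite almost everywhere and agree there
    with their [fine] parts. *)
Lemma ge0_hoelder f g p q :
  measurable_fun [set: T] f -> measurable_fun [set: T] g ->
  (forall x, 0 <= f x) -> (forall x, 0 <= g x) ->
  (0 < p)%R -> (0 < q)%R -> (p^-1 + q^-1 = 1)%R ->
  \int[mu]_x (f x * g x) <= pnorm mu p f * pnorm mu q g.
Proof.
move=> mf mg f0 g0 p0 q0 pq.
have zero u v : measurable_fun [set: T] u -> measurable_fun [set: T] v ->
    {ae mu, forall x, u x = 0} -> \int[mu]_x (u x * v x) = 0.
  move=> mu_ mv u0; rewrite (ae_eq_integral (cst 0))//.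
  - by rewrite integral0.
  - exact: emeasurable_funM.
  - by apply: filterS u0 => x ux _; rewrite ux mul0e.
have [Nf0|Nf0] := eqVneq (pnorm mu p f) 0.
  by rewrite Nf0 mul0e zero//; exact: pnorm_eq0_ae Nf0.
have [Ng0|Ng0] := eqVneq (pnorm mu q g) 0.
  under eq_integral do rewrite muleC.
  by rewrite Ng0 mule0 zero//; exact: pnorm_eq0_ae Ng0.
have Nf_gt0 : 0 < pnorm mu p f by rewrite lt0e Nf0 pnorm_ge0.
have Ng_gt0 : 0 < pnorm mu q g by rewrite lt0e Ng0 pnorm_ge0.
have [Nfoo|] := eqVneq (pnorm mu p f) +oo.
  by rewrite Nfoo gt0_mulye// leey.
rewrite -ltey => Nfoo.
have [Ngoo|] := eqVneq (pnorm mu q g) +oo.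
  by rewrite Ngoo gt0_muley// leey.
rewrite -ltey => Ngoo.
have ff := pnorm_fin_ae p0 mf f0 Nfoo.
have fg := pnorm_fin_ae q0 mg g0 Ngoo.
have mf' : measurable_fun [set: T] (fine \o f) by exact: measurableT_comp.
have mg' : measurable_fun [set: T] (fine \o g) by exact: measurableT_comp.
have pn u s : (0 < s)%R -> measurable_fun [set: T] u -> (forall x, 0 <= u x) ->
    {ae mu, forall x, u x \is a fin_num} ->
    'N[mu]_s%:E[EFin \o (fine \o u)] = pnorm mu s u.
  move=> s0 mu_ u0 uf; rewrite Lnorm_pnorm => [|x]; last by rewrite lee_fin fine_ge0.
  congr (_ `^ _); apply: ae_eq_integral => //.
  - apply: measurable_poweR_comp; apply/measurable_EFinP; exact: measurableT_comp.
  - exact: measurable_poweR_comp.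
  - by apply: filterS uf => x ux _; rewrite -[in RHS](fineK ux).
have := hoelder mu mf' mg' p0 q0 pq.
rewrite !pn//; apply: le_trans.
rewrite Lnorm1 le_eqVlt; apply/orP; left; apply/eqP.
apply: ae_eq_integral => //.
- exact: emeasurable_funM.
- by apply: measurableT_comp => //; apply/measurable_EFinP; apply: measurable_funM.
- apply: filterS2 ff fg => x fx gx _ /=.
  by rewrite ger0_norm ?mulr_ge0 ?fine_ge0// EFinM !fineK.
Qed.

End pnorm.

(** * Minkowski's integral inequality *)

Section minkowski_integral.
Local Open Scope ereal_scope.
Context d1 d2 (T1 : measurableType d1) (T2 : measurableType d2) (R : realType).
Variable m1 : {sigma_finite_measure set T1 -> \bar R}.
Variable m2 : {sigma_finite_measure set T2 -> \bar R}.
Variable h : T1 * T2 -> \bar R.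
Hypothesis mh : measurable_fun [set: T1 * T2] h.
Hypothesis h0 : forall z, 0 <= h z.

Lemma measurable_section1 y : measurable_fun [set: T1] (fun x => h (x, y)).
Proof. exact: measurableT_comp. Qed.

Lemma measurable_section2 x : measurable_fun [set: T2] (fun y => h (x, y)).
Proof. exact: measurableT_comp. Qed.

Lemma measurable_pnorm_section r :
  measurable_fun [set: T2] (fun y => pnorm m1 r (fun x => h (x, y))).
Proof.
apply: measurable_poweR_comp.
apply: (measurable_fun_fubini_tonelli_G (fun z => h z `^ r)) => [|z].
  exact: measurable_poweR_comp.
exact: poweR_ge0.
Qed.

Lemma measurable_integral_section :
  measurable_fun [set: T1] (fun x => \int[m2]_y h (x, y)).
Proof. exact: (measurable_fun_fubini_tonelli_F h). Qed.

(** Tonelli when [r = 1]. Otherwise duality: with [H^r] written as [H * H^(r-1)], Tonelli and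
    Hoelder in [x] for fixed [y] bound its integral by [B] times the norm of [H^(r-1)], and that
    norm is divided out. The division needs a finite norm, hence the truncations [Hk]. *)
Lemma minkowski_integral r : (1 <= r)%R ->
  pnorm m1 r (fun x => \int[m2]_y h (x, y)) <=
  \int[m2]_y pnorm m1 r (fun x => h (x, y)).
Proof.
rewrite le_eqVlt => /predU1P[<-|r1].
  rewrite pnorm1 => [|x]; last exact: integral_ge0.
  under [leRHS]eq_integral do rewrite pnorm1//.
  by rewrite (fubini_tonelli h).
have r0 : (0 < r)%R by rewrite (lt_trans _ r1).
have rN0 : r != 0%R by rewrite gt_eqF.
set H := fun x => _; set B := \int[m2]_y _.
have mH : measurable_fun [set: T1] H by exact: measurable_integral_section.
have H0 x : 0 <= H x by exact: integral_ge0.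
have B0 : 0 <= B by apply: integral_ge0 => y _; exact: pnorm_ge0.
have /sigma_finiteP[E [ET ndE Eoo]] := sigma_finiteT m1.
(* Cut in height at [k] and in space to a set of finite measure, so that the integral [A k] of the
   [r]-th power is finite. *)
pose Hk k x := mine (H x) k%:R%:E * (\1_(E k) x)%:E.
have mHk k : measurable_fun [set: T1] (Hk k).
  apply: emeasurable_funM; first exact: measurable_mine.
  by apply/measurable_EFinP; apply: measurable_indic; case: (Eoo k).
have Hk0 k x : 0 <= Hk k x.
  by rewrite mule_ge0// ?lee_fin// le_min H0 lee_fin/=.
have HkH k x : Hk k x <= H x.
  rewrite /Hk indicE; case: (x \in E k); rewrite ?mule1 ?mule0//.
  by rewrite ge_min lexx.
pose A k := \int[m1]_x (Hk k x `^ r).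
have A0 k : 0 <= A k by apply: integral_ge0 => x _; exact: poweR_ge0.
have Afin k : A k \is a fin_num.
  rewrite ge0_fin_numE//.
  apply: (@le_lt_trans _ _ (\int[m1]_x ((k%:R `^ r)%:E * (\1_(E k) x)%:E))).
    apply: ge0_le_integral => //.
    - by move=> x _; exact: poweR_ge0.
    - exact: measurable_poweR_comp.
    - apply: emeasurable_funM => //.
      by apply/measurable_EFinP; apply: measurable_indic; case: (Eoo k).
    - move=> x _; rewrite /Hk indicE; case: (x \in E k); rewrite ?mule1 ?mule0.
        rewrite -poweR_EFin; apply: le_poweR; rewrite ?(ltW r0)//.
          by rewrite le_min H0 lee_fin/=.
        by rewrite ge_min lexx orbT.
      by rewrite poweR0r.
  rewrite ge0_integralZl//; last first.
    by apply/measurable_EFinP; apply: measurable_indic; case: (Eoo k).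
  rewrite integral_indic// ?setIT; last by case: (Eoo k).
  by apply: lte_mul_pinfty; rewrite ?lee_fin ?powR_ge0//; case: (Eoo k).
have key k : A k <= B `^ r.
  have [->|Ak0] := eqVneq (A k) 0; first exact: poweR_ge0.
  have Ak_gt0 : 0 < A k by rewrite lt0e Ak0 A0.
  pose q := (r / (r - 1))%R.
  have rB1 : (0 < r - 1)%R by rewrite subr_gt0.
  have q0 : (0 < q)%R by rewrite divr_gt0.
  have pq : (r^-1 + q^-1 = 1)%R.
    by rewrite /q invf_div mulrBl mul1r mulfV// addrC subrK.
  (* Since [(r - 1) * q = r], the [q]-norm of [v] is a power of [A k] itself. *)
  pose v x := Hk k x `^ (r - 1).
  have mv : measurable_fun [set: T1] v by exact: measurable_poweR_comp.
  have v0 x : 0 <= v x by exact: poweR_ge0.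
  have Nv : pnorm m1 q v = A k `^ q^-1.
    congr (_ `^ _); apply: eq_integral => x _.
    by rewrite /v -poweRrM /q mulrC divfK// gt_eqF.
  have AB : A k <= B * A k `^ q^-1.
    apply: (@le_trans _ _ (\int[m1]_x (H x * v x))).
      apply: ge0_le_integral => //.
      - by move=> x _; exact: poweR_ge0.
      - exact: measurable_poweR_comp.
      - exact: emeasurable_funM.
      - move=> x _; rewrite [X in X <= _](_ : _ = Hk k x * v x).
          by apply: lee_wpmul2r.
        have [->|Hx0] := eqVneq (Hk k x) 0; first by rewrite poweR0r// mul0e.
        rewrite /v -{2}(poweRe1 (Hk0 k x)) -poweRD.
          by rewrite addrC subrK.
        by apply: nneg_neq0_poweRD_def => //; exact: ltW.
    pose hv (z : T1 * T2) := h z * v z.1.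
    have mhv : measurable_fun [set: T1 * T2] hv.
      by apply: emeasurable_funM => //; exact: measurableT_comp.
    have hv0 z : 0 <= hv z by exact: mule_ge0.
    have -> : \int[m1]_x (H x * v x) = \int[m1]_x \int[m2]_y hv (x, y).
      apply: eq_integral => x _; rewrite /hv/= ge0_integralZr//.
      exact: measurable_section2.
    rewrite (fubini_tonelli hv)//.
    have -> : B * A k `^ q^-1 = \int[m2]_y (pnorm m1 r (fun x => h (x, y)) * A k `^ q^-1).
      rewrite ge0_integralZr//.
      - exact: measurable_pnorm_section.
      - by move=> y _; exact: pnorm_ge0.
      - exact: poweR_ge0.
    apply: ge0_le_integral => //.
    - by move=> y _; apply: integral_ge0 => x _.
    - exact: (measurable_fun_fubini_tonelli_G hv).
    - by apply: emeasurable_funM => //; exact: measurable_pnorm_section.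
    - move=> y _; rewrite -Nv; apply: ge0_hoelder => //.
      exact: measurable_section1.
  have : A k `^ r^-1 <= B.
    have Aq0 : 0 < A k `^ q^-1 by exact: poweR_gt0.
    have Aqfin : A k `^ q^-1 \is a fin_num by exact: fin_num_poweR.
    rewrite -(@lee_pmul2r _ (A k `^ q^-1))// -poweRD.
      by rewrite pq poweRe1.
    by apply: nneg_neq0_poweRD_def; rewrite ?invr_ge0 ?ltW.
  move=> /(le_poweR (ltW r0) (poweR_ge0 _ _)).
  by rewrite -poweRrM mulVf// poweRe1.
suff : \int[m1]_x (H x `^ r) <= B `^ r.
  have rV0 : (0 <= r^-1)%R by rewrite invr_ge0 ltW.
  move=> /(le_poweR rV0); rewrite -poweRrM mulfV// poweRe1//; apply.
  by apply: integral_ge0 => x _; exact: poweR_ge0.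
(* Monotone convergence. Where [H x = +oo] the truncations equal [k] from some rank on, and [k^r] is
   unbounded. *)
have cvgA : A k @[k --> \oo] --> \int[m1]_x (H x `^ r).
  rewrite [X in _ --> X](_ : _ = \int[m1]_x limn (fun k => Hk k x `^ r)).
    apply: cvg_monotone_convergence => //.
    - by move=> k; exact: measurable_poweR_comp.
    - by move=> k x _; exact: poweR_ge0.
    - move=> x _ k l kl; apply: le_poweR; rewrite ?(ltW r0)//.
      have : E k `<=` E l by apply/subsetPset; exact: ndE.
      rewrite /Hk !indicE; have [xk /(_ x)|xk _] := boolP (x \in E k); last first.
        by rewrite mule0 Hk0.
      move=> xl; rewrite (mem_set (xl _)); last exact: set_mem.
      rewrite !mule1 le_min ge_min lexx/= ge_min; apply/orP; right.
      by rewrite lee_fin ler_nat.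
  apply: eq_integral => x _; apply/esym/cvg_lim => //.
  have [k0 _ Ek0] : (\bigcup_i E i) x by rewrite -ET.
  have Elarge k : (k0 <= k)%N -> x \in E k.
    by move=> k0k; rewrite inE; move: Ek0; exact/subsetPset/ndE.
  case Hx : (H x) (H0 x) => [a| |]// a0.
    apply: cvg_near_cst; exists (maxn k0 (Num.trunc a).+1) => // k /=.
    rewrite geq_max => /andP[kk0 ka]; rewrite /Hk indicE Elarge// mule1 Hx.
    rewrite (@min_idPl _ _ a%:E _ _)// lee_fin ltW//.
    rewrite (lt_le_trans (truncnS_gt _))// ler_nat//.
  rewrite eqy_poweR//.
  apply: (@cvg_trans _ ((k%:R `^ r)%:E @[k --> \oo])).
    apply: near_eq_cvg; exists k0 => // k /= kk0.
    by rewrite /Hk indicE Elarge// mule1 Hx minye poweR_EFin.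
  apply/cvgeryP/cvgryPge => M.
  exists (Num.trunc (`|M| `^ r^-1)%R).+1 => // k /= kM.
  rewrite (le_trans (ler_norm M))//.
  have -> : `|M|%R = ((`|M| `^ r^-1) `^ r)%R.
    by rewrite -powRrM mulVf// powRr1.
  apply: ge0_ler_powR; rewrite ?(ltW r0)// ?nnegrE ?powR_ge0//.
  by rewrite ltW// (lt_le_trans (truncnS_gt _))// ler_nat.
rewrite -(cvg_lim _ cvgA)//.
apply: lime_le; first by apply/cvg_ex; eexists; exact: cvgA.
exact: nearW.
Qed.

End minkowski_integral.

(** The direct inequality for [h^r], with exponent [1/r] and the two variables exchanged, becomes
    this one after raising both sides to the power [1/r]. *)
Lemma minkowski_integral_reverse d1 d2 (T1 : measurableType d1)
    (T2 : measurableType d2) (R : realType)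
    (m1 : {sigma_finite_measure set T1 -> \bar R})
    (m2 : {sigma_finite_measure set T2 -> \bar R})
    (h : T1 * T2 -> \bar R) (r : R) :
  measurable_fun [set: T1 * T2] h -> (forall z, 0 <= h z)%E -> 0 < r <= 1 ->
  (\int[m2]_y pnorm m1 r (fun x => h (x, y)) <=
   pnorm m1 r (fun x => \int[m2]_y h (x, y)))%E.
Proof.
move=> mh h0 /andP[r0 r1].
pose k (z : T2 * T1) := (h (z.2, z.1) `^ r)%E.
have mk : measurable_fun [set: T2 * T1] k.
  apply: measurable_poweR_comp; apply: measurableT_comp => //=.
  exact: measurable_swap.
have k0 z : (0 <= k z)%E by exact: poweR_ge0.
have rV1 : 1 <= r^-1 by rewrite invf_ge1.
have rV0 : 0 <= r^-1 by rewrite invr_ge0 ltW.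
have := minkowski_integral m2 m1 mk k0 rV1.
move=> /(le_poweR rV0 (pnorm_ge0 _ _ _)).
rewrite {1}/pnorm invrK -poweRrM mulfV ?gt_eqF// poweRe1; last first.
  by apply: integral_ge0 => y _; exact: poweR_ge0.
move/le_trans; apply; rewrite le_eqVlt; apply/orP; left; apply/eqP.
congr (_ `^ _)%E; apply: eq_integral => x _.
rewrite /pnorm invrK; congr (_ `^ _)%E.
apply: eq_integral => y _; rewrite /k/= -poweRrM mulfV ?gt_eqF// poweRe1//.
Qed.

(** * Increasing continuously differentiable substitutions on the line *)

Section substitution.
Context (R : realType).
Local Notation lambda := (@lebesgue_measure R).
Variables (S s : R -> R).
Hypothesis dS : forall x : R, is_derive x 1 S (s x).
Hypothesis cs : continuous s.
Hypothesis s0 : forall x, 0 < s x.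
Hypothesis ontoS : forall y, exists x, S x = y.

Lemma C1_continuous : continuous S.
Proof.
move=> x; apply: differentiable_continuous; apply/derivable1_diffP.
by case: (dS x).
Qed.

Lemma C1_measurable : measurable_fun [set: R] S.
Proof. by apply: continuous_measurable_fun; exact: C1_continuous. Qed.

Lemma C1_derive1 x : (S^`())%classic x = s x.
Proof. by rewrite derive1E; exact: derive_val. Qed.

Lemma C1_lt : {mono S : x y / x < y}.
Proof.
suff h : {homo S : x y / x < y}.
  by apply: leW_mono; apply: le_mono => x y; exact: h.
move=> x y xy.
have [|c _] := MVT xy (fun z _ => dS z).
  by apply: continuous_subspaceT; exact: C1_continuous.
by rewrite -subr_gt0 => ->; rewrite mulr_gt0// subr_gt0.
Qed.

Lemma C1_image_oc (c d : R) : S @^-1` `]S c, S d] = `]c, d]%classic.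
Proof.
have le_S x y : (S x <= S y) = (x <= y) by rewrite !leNgt C1_lt.
by apply/seteqP; split => x; rewrite /= !in_itv/= C1_lt le_S.
Qed.

Local Definition nu (A : set (measurableTypeR R)) : \bar R :=
  (\int[lambda]_(x in S @^-1` A) (s x)%:E)%E.

Local Lemma ms : measurable_fun [set: R] s.
Proof. exact: continuous_measurable_fun. Qed.

Local Lemma nu0 : nu set0 = 0%E.
Proof. by rewrite /nu preimage_set0 integral_set0. Qed.

Local Lemma nu_ge0 A : (0 <= nu A)%E.
Proof. by apply: integral_ge0 => x _; rewrite lee_fin ltW. Qed.

Local Lemma nu_sigma_additive : semi_sigma_additive nu.
Proof.
move=> F mF tF mUF; rewrite /nu preimage_bigcup.
apply: (@semi_sigma_additive_nng_induced _ _ _ lambda (EFin \o s)).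
- by apply/measurable_EFinP; exact: ms.
- by move=> x; rewrite lee_fin ltW.
- move=> k; rewrite -[X in measurable X]setTI.
  by apply: C1_measurable; [exact: measurableT|exact: mF].
- apply/trivIsetP => /= i j _ _ ij; rewrite -preimage_setI.
  by move/trivIsetP : tF => /(_ _ _ _ _ ij) ->//; rewrite preimage_set0.
- rewrite -preimage_bigcup -[X in measurable X]setTI.
  by apply: C1_measurable; [exact: measurableT|exact: mUF].
Qed.

HB.instance Definition _ := isMeasure.Build _ _ _ nu nu0 nu_ge0 nu_sigma_additive.

(** By uniqueness of Lebesgue measure it suffices to compare on intervals []a, b]]. Surjectivity
    gives [a = S c] and [b = S d]; the preimage is []c, d]], and the integral of [s] over it is
    [S d - S c] by the fundamental theorem of calculus. *)
Local Lemma nuE A : measurable A -> lambda A = nu A.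
Proof.
apply: lebesgue_measure_unique => X /ocitvP[->|[[a b]/= ab ->]].
  by rewrite !measure0.
have [c Sc] := ontoS a; have [d Sd] := ontoS b.
move: ab; rewrite -Sc -Sd C1_lt => cd.
rewrite /nu C1_image_oc lebesgue_measure_itv/= lte_fin C1_lt cd.
rewrite integral_itv_obnd_cbnd; last by apply/measurable_EFinP; apply: measurable_funTS; exact: ms.
rewrite (@continuous_FTC2 _ s S)//.
- exact: continuous_subspaceT.
- split => [x _|  | ].
  + by case: (dS x).
  + by apply: cvg_at_right_filter; exact: C1_continuous.
  + by apply: cvg_at_left_filter; exact: C1_continuous.
- by move=> x _; exact: C1_derive1.
Qed.

Lemma ge0_integral_subst (f : R -> \bar R) :
  measurable_fun [set: R] f -> (forall y, 0 <= f y)%E ->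
  (\int[lambda]_y f y = \int[lambda]_x (f (S x) * (s x)%:E))%E.
Proof.
move=> mf f0; apply: (@ge0_integral_transport _ _ _ _ _ lambda lambda S s) => //.
- exact: C1_measurable.
- exact: ms.
- by move=> x; exact: ltW.
- move=> A mA; transitivity (nu A); first exact: nuE.
  rewrite /nu [LHS]integral_mkcond; apply: eq_integral => x _.
  rewrite patchE indicE; have -> : (x \in S @^-1` A) = (S x \in A).
    by apply/idP/idP; rewrite !inE.
  by case: ifPn; rewrite ?mul1r ?mul0r.
Qed.

End substitution.

(** * Invariance of Lebesgue measure and monotone transport *)

Section lebesgue_invariance.
Context (R : realType).
Local Notation lambda := (@lebesgue_measure R).
Local Open Scope ereal_scope.
Variable f : R -> \bar R.
Hypothesis mf : measurable_fun [set: R] f.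
Hypothesis f0 : forall y, 0 <= f y.

Lemma ge0_integral_shift (c : R) :
  \int[lambda]_x f (x + c)%R = \int[lambda]_x f x.
Proof.
rewrite [RHS](@ge0_integral_subst R (fun x => x + c)%R (fun=> 1%R))//.
- by apply: eq_integral => x _; rewrite mule1.
- move=> x; rewrite -[X in is_derive _ _ _ X]addr0.
  exact: is_deriveD.
- by move=> x; exact: cvg_cst.
- by move=> y; exists (y - c)%R; rewrite subrK.
Qed.

Lemma ge0_integral_opp : \int[lambda]_x f (- x)%R = \int[lambda]_x f x.
Proof.
transitivity (\int[pushforward lambda (-%R : _ -> measurableTypeR R)]_x f x).
  by rewrite ge0_integral_pushforward.
apply: eq_measure_integral => A mA _; exact: lebesgue_measureN.
Qed.

End lebesgue_invariance.

Lemma ge0_integral_reflect (R : realType) (f : R -> \bar R) (c : R) :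
  measurable_fun [set: R] f -> (forall y, 0 <= f y)%E ->
  (\int[@lebesgue_measure R]_x f (c - x)%R = \int[@lebesgue_measure R]_x f x)%E.
Proof.
move=> mf f0; rewrite -(ge0_integral_shift mf f0 c).
rewrite -(ge0_integral_opp (f := fun x => f (x + c)%R))//.
  by apply: eq_integral => x _; rewrite addrC.
by apply: measurableT_comp => //; exact: measurable_funD.
Qed.

Section cdf.
Context (R : realType).
Local Notation lambda := (@lebesgue_measure R).
Variable f : R -> R.
Hypothesis cf : continuous f.
Hypothesis f0 : forall x, 0 < f x.
Hypothesis intf : lambda.-integrable [set: R] (EFin \o f).

Let cdf x := \int[lambda]_(t in `]-oo, x]) f t.
Let M := \int[lambda]_t f t.

Lemma is_derive_cdf (x : R) : is_derive x 1 cdf (f x).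
Proof.
have intx : lambda.-integrable [set` `]-oo, x + 1]] (EFin \o f).
  exact: integrableS intf.
have xx1 : x < x + 1 by rewrite ltrDl.
have [df dfE] := @continuous_FTC1 R f -oo%O x (x + 1) xx1 intx (ltNyr _) (@cf x).
by apply: DeriveDef; [exact: df|rewrite -derive1E dfE].
Qed.

(** The mass of [I n] tends to [M]. Once the missing mass is below both [z] and [M - z], [cdf] is at
    most [z] at [- n] and at least [z] at [n], and the intermediate value theorem applies. *)
Lemma cdf_onto z : 0 < z < M -> exists x, cdf x = z.
Proof.
move=> /andP[z0 zM].
pose I (n : nat) : set (measurableTypeR R) := `](- n%:R : R), n%:R]%classic.
have mI n : measurable (I n) by exact: measurable_itv.
have iT : \bigcup_n I n = [set: R].
  apply/seteqP; split => // x _; exists (Num.trunc `|x|).+1 => //=.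
  have := truncnS_gt `|x|; rewrite /I/= in_itv/= ltr_norml.
  by move=> /andP[-> /ltW ->].
have H : (\int[lambda]_(x in I n) (f x)%:E)%E @[n --> \oo] -->
    (\int[lambda]_x (f x)%:E)%E.
  rewrite -[X in _ --> integral _ X _]iT.
  apply: ge0_nondecreasing_set_cvg_integral.
  - move=> m n mn; apply/subsetPset; apply: subset_itv; rewrite bnd_simp.
      by rewrite lerN2 ler_nat.
    by rewrite ler_nat.
  - exact: mI.
  - move=> i; apply: measurable_funTS; apply/measurable_EFinP.
    exact: continuous_measurable_fun.
  - by move=> i x _; rewrite lee_fin ltW.
have intA (A : set (measurableTypeR R)) : measurable A ->
    lambda.-integrable A (EFin \o f) by move=> mA; exact: integrableS intf.
have [n Hn] : exists n : nat, M - Num.min z (M - z) <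
    \int[lambda]_(x in I n) f x.
  apply: contrapT => nex.
  have : (\int[lambda]_x (f x)%:E <= (M - Num.min z (M - z))%:E)%E.
    apply: (cvge_to_le H); apply: nearW => n.
    rewrite -(fineK (integrable_fin_num (mI n) (intA _ (mI n)))) lee_fin leNgt; apply/negP => h; apply: nex.
    by exists n.
  rewrite -(fineK (integrable_fin_num measurableT intf)) lee_fin.
  by rewrite leNgt gtrBl lt_min z0 subr_gt0 zM.
have cdf0 x : 0 <= cdf x by apply: Rintegral_ge0 => y _; exact: ltW.
have cdfM x : cdf x <= M.
  rewrite -subr_ge0 /M /cdf -set_itvNyy Rintegral_itvB//.
    by apply: Rintegral_ge0 => y _; exact: ltW.
  by rewrite set_itvNyy.
have cdfB : cdf n%:R - cdf (- n%:R) =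
    \int[lambda]_(x in I n) f x.
  rewrite /cdf Rintegral_itvB//; first exact: intA.
  by rewrite bnd_simp ge0_cp.
rewrite -cdfB in Hn.
have zn : z <= cdf n%:R.
  have := cdf0 (- n%:R); have : Num.min z (M - z) <= M - z by rewrite ge_min lexx orbT.
  lra.
have zNn : cdf (- n%:R) <= z.
  have := cdfM n%:R; have : Num.min z (M - z) <= z by rewrite ge_min lexx.
  lra.
have cN : (- n%:R : R) <= n%:R by rewrite ge0_cp.
have [||c _ cz] := @IVT _ cdf _ _ z cN.
- apply: continuous_subspaceT; exact: (C1_continuous is_derive_cdf).
- by rewrite ge_min zNn/= le_max zn orbT.
by exists c.
Qed.

Lemma cdf_itv x : 0 < cdf x < M.
Proof.
have cdf0 y : 0 <= cdf y by apply: Rintegral_ge0 => t _; exact: ltW.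
have cdfM y : cdf y <= M.
  rewrite -subr_ge0 /M /cdf -set_itvNyy Rintegral_itvB//.
    by apply: Rintegral_ge0 => t _; exact: ltW.
  by rewrite set_itvNyy.
have mono := C1_lt is_derive_cdf f0.
apply/andP; split.
  by rewrite (le_lt_trans (cdf0 (x - 1)))// mono gtrBl.
by rewrite (lt_le_trans _ (cdfM (x + 1)))// mono ltrDl.
Qed.

End cdf.

(** [S] is the distribution function of [F] followed by the inverse of that of [f]. Equal total
    masses give the two distribution functions the same open interval of values, so [S] is defined
    everywhere and onto. *)
Lemma monotone_transport (R : realType) (F f : R -> R) :
  continuous F -> continuous f -> (forall x, 0 < F x) -> (forall x, 0 < f x) ->
  (@lebesgue_measure R).-integrable [set: R] (EFin \o F) ->
  (@lebesgue_measure R).-integrable [set: R] (EFin \o f) ->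
  \int[@lebesgue_measure R]_x F x = \int[@lebesgue_measure R]_x f x ->
  exists S s : R -> R, [/\ forall x : R, is_derive x 1 S (s x), continuous s,
    forall x, 0 < s x, forall y, exists x, S x = y &
    forall x, F x = f (S x) * s x].
Proof.
move=> cF cf F0 f0 iF if_ FfE.
pose P x := \int[@lebesgue_measure R]_(t in `]-oo, x]) F t.
pose p x := \int[@lebesgue_measure R]_(t in `]-oo, x]) f t.
have dP (x : R) : is_derive x 1 P (F x) by exact: is_derive_cdf.
have dp (x : R) : is_derive x 1 p (f x) by exact: is_derive_cdf.
have pinj : injective p.
  move=> x y pxy; apply/eqP; rewrite eq_le !leNgt.
  by rewrite -(C1_lt dp f0 y x) -(C1_lt dp f0 x y) pxy ltxx.
(* A left inverse of [p]. Off the range of [p] the condition is vacuous and the value [0] arbitrary;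
   [P] never leaves that range. *)
have /choice[g gE] : forall z, exists x, forall y, p y = z -> x = y.
  move=> z; have [[x xz]|nz] := pselect (exists x, p x = z).
    by exists x => y; rewrite -xz => /pinj.
  by exists 0 => y yz; exfalso; apply: nz; exists y.
have pK : cancel p g by move=> x; exact: gE.
have ex x : exists y, p y = P x.
  by apply: cdf_onto => //; rewrite -FfE; exact: cdf_itv.
have gK x : p (g (P x)) = P x.
  by have [y pyx] := ex x; rewrite -pyx pK.
have dg (x : R) : is_derive (p x) 1 g (f x)^-1.
  apply: is_derive_inverse => //.
  - exact: (filterE _ pK).
  - exact: (filterE _ (C1_continuous dp)).
  - by rewrite gt_eqF.
pose S := g \o P; pose s x := F x / f (S x).
have dS (x : R) : is_derive x 1 S (s x).
  have dgP : is_derive (P x) 1 g (f (S x))^-1 by rewrite -gK; exact: dg.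
  by have := is_derive1_comp dgP (dP x); rewrite mulrC.
exists S, s; split => //.
- move=> x; apply: cvgM; first exact: cF.
  apply: cvgV; first by rewrite gt_eqF.
  apply: (@continuous_comp _ _ _ S f); last exact: cf.
  exact: (C1_continuous dS).
- by move=> x; rewrite divr_gt0.
- move=> y; have [x Px] : exists x, P x = p y.
    by apply: cdf_onto => //; rewrite FfE; exact: cdf_itv.
  by exists x; rewrite /S/= Px pK.
- by move=> x; rewrite /s mulrCA mulfV ?mulr1// gt_eqF.
Qed.

(** * Gaussian integrals and the change of variables in the plane *)

Section gauss.
Context (R : realType).
Local Notation lambda := (@lebesgue_measure R).

Lemma integral_gauss_scale (a c : R) : 0 < a ->
  (\int[lambda]_x (expR (- (a * (x - c) ^+ 2)))%:E = (Num.sqrt (pi / a))%:E)%E.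
Proof.
move=> a0; have sa0 : 0 < Num.sqrt a by rewrite sqrtr_gt0.
pose S x := Num.sqrt a * x - Num.sqrt a * c.
have mG : measurable_fun [set: R] (EFin \o @gauss_fun R).
  by apply/measurable_EFinP; exact: measurable_gauss_fun.
have dS (x : R) : is_derive x 1 S (Num.sqrt a).
  have := is_deriveB (is_deriveZ (Num.sqrt a) (is_derive_id x 1)) (is_derive_cst (Num.sqrt a * c) x 1).
  by rewrite /GRing.scale/= mulr1 subr0.
have cS : continuous (fun _ : R => Num.sqrt a) by move=> x; exact: cvg_cst.
have oS y : exists x, S x = y.
  exists ((y + Num.sqrt a * c) / Num.sqrt a).
  by rewrite /S mulrCA mulfV ?gt_eqF// mulr1 addrK.
have G0 y : (0 <= (EFin \o @gauss_fun R) y)%E by rewrite lee_fin gauss_fun_ge0.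
have := ge0_integral_subst dS cS (fun=> sa0) oS mG G0.
rewrite integralT_gauss => H.
transitivity ((Num.sqrt a)^-1%:E * (Num.sqrt (pi : R))%:E)%E; last first.
  by rewrite -EFinM sqrtrM ?pi_ge0// sqrtrV ?(ltW a0)// mulrC.
rewrite H -ge0_integralZl//.
- apply: eq_integral => x _; rewrite -!EFinM; congr EFin.
  rewrite [RHS]mulrCA mulVf ?gt_eqF// mulr1 /= /gauss_fun; congr (expR (- _)).
  by rewrite /S -mulrBr exprMn sqr_sqrtr// ltW.
- apply: emeasurable_funM => //; apply: (measurableT_comp mG).
  exact: (C1_measurable dS).
- by move=> x _; rewrite -EFinM lee_fin mulr_ge0 ?gauss_fun_ge0 ?(ltW sa0).
Qed.

Lemma measurable_gauss_scale (a c : R) :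
  measurable_fun [set: R] (fun x : R => expR (- (a * (x - c) ^+ 2))).
Proof.
apply: (@measurableT_comp _ _ _ _ _ _ (@expR R)) => //.
apply: measurableT_comp => //; apply: measurable_funM => //.
by apply: measurable_funX; apply: measurable_funB.
Qed.

Lemma integrable_gauss_scale (a c : R) : 0 < a ->
  lambda.-integrable [set: R] (fun x => (expR (- (a * (x - c) ^+ 2)))%:E).
Proof.
move=> a0; apply/integrableP; split.
  by apply/measurable_EFinP; exact: measurable_gauss_scale.
under eq_integral do rewrite gee0_abs ?lee_fin ?expR_ge0//.
by rewrite integral_gauss_scale// ltry.
Qed.

End gauss.

Section change_of_variables2.
Context (R : realType).
Local Notation lambda := (@lebesgue_measure R).
Local Notation T := (measurableTypeR R).
Variables (S s U u : R -> R).
Hypothesis dS : forall x : R, is_derive x 1 S (s x).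
Hypothesis dU : forall x : R, is_derive x 1 U (u x).
Hypothesis cs : continuous s.
Hypothesis cu : continuous u.
Hypothesis s0 : forall x, 0 < s x.
Hypothesis u0 : forall x, 0 < u x.
Hypothesis ontoS : forall y, exists x, S x = y.
Hypothesis ontoU : forall y, exists x, U x = y.
Variables (m n : R).
Hypothesis mn : m + n = 1.
Local Open Scope ereal_scope.

(** The map from [(a, b)] to [(x, y)] is a composition of shears with [S] and [U] acting on one
    coordinate each. Every factor is a translation or a one-dimensional substitution inside an
    iterated integral, with Tonelli to exchange the order; the shears cost nothing, so the Jacobian
    is the product of [s] and [u]. *)
Lemma ge0_integral2_change (H : T * T -> \bar R) :
  measurable_fun [set: T * T] H -> (forall z, 0 <= H z) ->
  \int[lambda]_x \int[lambda]_y H (x, y) =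
  \int[lambda]_b \int[lambda]_a
    (H ((S (m * a - b) + U (b + n * a))%R, U (b + n * a)%R) *
      (s (m * a - b) * u (b + n * a))%R%:E).
Proof.
move=> mH H0.
have mS : measurable_fun [set: T] S by exact: C1_measurable dS.
have mU : measurable_fun [set: T] U by exact: C1_measurable dU.
have ms : measurable_fun [set: T] s by exact: continuous_measurable_fun.
have mu : measurable_fun [set: T] u by exact: continuous_measurable_fun.
pose H1 (z : T * T) := H ((z.1 + z.2)%R, z.2).
have mH1 : measurable_fun [set: T * T] H1.
  apply: (measurableT_comp mH); apply: measurable_fun_pair => //=.
  exact: measurable_funD.
pose H2 (z : T * T) := H ((S z.1 + z.2)%R, z.2) * (s z.1)%:E.
have mH2 : measurable_fun [set: T * T] H2.
  apply: emeasurable_funM; last first.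
    by apply/measurable_EFinP; exact: measurableT_comp.
  apply: (measurableT_comp mH); apply: measurable_fun_pair => //=.
  by apply: measurable_funD => //; exact: measurableT_comp.
have H20 z : 0 <= H2 z by rewrite mule_ge0// lee_fin ltW.
pose K (z : T * T) := H ((S z.1 + U z.2)%R, U z.2) * (s z.1 * u z.2)%:E.
have mK : measurable_fun [set: T * T] K.
  apply: emeasurable_funM; last first.
    by apply/measurable_EFinP; apply: measurable_funM; exact: measurableT_comp.
  apply: (measurableT_comp mH); apply: measurable_fun_pair => /=.
    by apply: measurable_funD => //; exact: measurableT_comp.
  exact: measurableT_comp.
have K0 z : 0 <= K z by rewrite mule_ge0// lee_fin mulr_ge0// ltW.
pose K1 (z : T * T) := K ((z.2 - z.1)%R, z.1).
have mK1 : measurable_fun [set: T * T] K1.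
  apply: (measurableT_comp mK); apply: measurable_fun_pair => //=.
  exact: measurable_funB.
pose K2 (z : T * T) := K ((m * z.1 - z.2)%R, (z.2 + n * z.1)%R).
have mK2 : measurable_fun [set: T * T] K2.
  apply: (measurableT_comp mK); apply: measurable_fun_pair => //=.
    by apply: measurable_funB => //; exact: measurable_funM.
  by apply: measurable_funD => //; exact: measurable_funM.
transitivity (\int[lambda]_y \int[lambda]_x H1 (x, y)).
  etransitivity; first exact: (@fubini_tonelli _ _ _ _ _ lambda lambda H mH H0).
  apply: eq_integral => y _.
  rewrite -(@ge0_integral_shift R (fun x => H (x, y)) _ _ y)//.
  exact: measurableT_comp.
transitivity (\int[lambda]_y \int[lambda]_x H2 (x, y)).
  apply: eq_integral => y _.
  rewrite (ge0_integral_subst dS cs s0 ontoS (f := fun x => H1 (x, y)))//.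
    exact: measurableT_comp.
  by move=> x; exact: H0.
transitivity (\int[lambda]_y \int[lambda]_x K (x, y)).
  rewrite (ge0_integral_subst dU cu u0 ontoU (f := fun y => \int[lambda]_x H2 (x, y)))//.
  - apply: eq_integral => y _; rewrite -ge0_integralZr//.
    + by apply: eq_integral => x _; rewrite /H2 /K/= EFinM muleA.
    + exact: (measurableT_comp mH2).
    + by rewrite lee_fin ltW.
  - exact: (measurable_fun_fubini_tonelli_G H2).
  - by move=> y; exact: integral_ge0.
transitivity (\int[lambda]_y \int[lambda]_x K1 (y, x)).
  apply: eq_integral => y _.
  rewrite -(@ge0_integral_shift R (fun x => K (x, y)) _ _ (- y)%R)//.
  exact: (measurableT_comp mK).
etransitivity.
  exact: (@fubini_tonelli _ _ _ _ _ lambda lambda K1 mK1 (fun=> K0 _)).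
(* Replacing [y] by [b + n * a] turns [a - y] into [a - b - n * a = m * a - b]; this is where
   [m + n = 1] enters. *)
transitivity (\int[lambda]_x \int[lambda]_y K2 (x, y)).
  apply: eq_integral => a _.
  rewrite -(@ge0_integral_shift R (fun y => K1 (y, a)) _ _ (n * a)%R)//.
    apply: eq_integral => b _; rewrite /K1 /K2/=; congr (K (_, _)).
    by rewrite -[X in (X - _)%R]mul1r -mn; ring.
    exact: (measurableT_comp mK1).
  by move=> y; exact: K0.
exact: (@fubini_tonelli _ _ _ _ _ lambda lambda K2 mK2 (fun=> K0 _)).
Qed.

End change_of_variables2.

(** * The one-dimensional inequality for Gaussian-dominated functions *)

Section pointwise.
Context (R : realType).
Implicit Types (a b l x y : R).

(** Convexity: [expR] lies above its tangent at the weighted mean [c], and the linear terms cancel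
    in the weighted sum. *)
Lemma weighted_amgm_expR a b l : 0 <= l <= 1 ->
  expR (l * a + (1 - l) * b) <= l * expR a + (1 - l) * expR b.
Proof.
move=> /andP[l0 l1]; set c := l * a + _.
have H z : expR c * (1 + (z - c)) <= expR z.
  have -> : expR z = expR c * expR (z - c) by rewrite -expRD addrC subrK.
  rewrite ler_wpM2l ?expR_ge0//.
  exact: expR_ge1Dx.
have Ha := ler_wpM2l l0 (H a).
have Hb : (1 - l) * (expR c * (1 + (b - c))) <= (1 - l) * expR b.
  by apply: ler_wpM2l => //; rewrite subr_ge0.
apply: le_trans (lerD Ha Hb); rewrite le_eqVlt; apply/orP; left; apply/eqP.
by rewrite /c; ring.
Qed.

Lemma powR_expR a x : expR a `^ x = expR (x * a).
Proof. by rewrite /powR gt_eqF ?expR_gt0// expRK. Qed.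

Variables (p q r m n : R).
Hypotheses (p0 : 0 < p) (q0 : 0 < q) (r0 : 0 < r) (m0 : 0 < m) (n0 : 0 < n).
Hypothesis mn : m + n = 1.
Hypothesis rp : r / p = 1 + (r - 1) * n.
Hypothesis rq : r / q = 1 + (r - 1) * m.
Variables (f g s t w tau : R).
Hypotheses (f0 : 0 < f) (g0 : 0 < g) (s0 : 0 < s) (t0 : 0 < t).
Hypotheses (w0 : 0 < w) (tau0 : 0 < tau).

(* [X] is the transported integrand. The free parameter [tau] balances the two
   terms of Young's inequality for products; its optimal value is fixed in the
   proof of the one-dimensional inequality. *)
Let X := f * g * (s * t) * w `^ (r - 1).
Let Y := tau `^ (r - 1) * ((f `^ p * s) `^ (r / p) * (g `^ q * t) `^ (r / q)).
Let Z := (m * s + n * t) * w `^ r / tau.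

Local Lemma theta_gt0 : 0 < m * s + n * t.
Proof. by rewrite addr_gt0// mulr_gt0. Qed.

Let h := ln (m * s + n * t).

(** The arithmetic-geometric mean inequality for [s] and [t] in logarithmic form. The sign of
    [r - 1] decides in which direction it is used. *)
Local Lemma hE : m * ln s + n * ln t <= h.
Proof.
rewrite -ler_expR lnK ?posrE ?theta_gt0//.
have := @weighted_amgm_expR (ln s) (ln t) m.
have -> : 1 - m = n by rewrite -mn addrC addKr.
rewrite !lnK ?posrE//; apply; rewrite (ltW m0)/=.
by rewrite -mn lerDl ltW.
Qed.

Local Lemma XE : X = expR (ln f + ln g + ln s + ln t + (r - 1) * ln w).
Proof.
by rewrite /X -{1}(lnK f0) -{1}(lnK g0) -{1}(lnK s0) -{1}(lnK t0) -{1}(lnK w0)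
  powR_expR -!expRD; congr expR; ring.
Qed.

Local Lemma ZE : Z = expR (h + r * ln w - ln tau).
Proof.
by rewrite /Z -{1}(lnK w0) -{1}(lnK tau0) -[X in X * _ / _](lnK theta_gt0)
  powR_expR -expRN -!expRD.
Qed.

Local Lemma YE : Y = expR ((r - 1) * ln tau + r * (ln f + ln g) +
  r / p * ln s + r / q * ln t).
Proof.
rewrite /Y -{1}(lnK f0) -{1}(lnK g0) -{1}(lnK s0) -{1}(lnK t0) -{1}(lnK tau0).
rewrite !powR_expR -!expRD !powR_expR -!expRD; congr expR; field.
by rewrite !gt_eqF.
Qed.

(** [expR y] is [X^r / Z^(r-1)], where the powers of [w] cancel. The quotient of [Y] by it is the
    arithmetic-geometric mean defect of [s] and [t] to the power [r - 1]. *)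
Let y := (r - 1) * ln tau + r * (ln f + ln g + ln s + ln t) + (1 - r) * h.

Local Lemma yE : (r - 1) * ln tau + r * (ln f + ln g) + r / p * ln s + r / q * ln t - y =
  (r - 1) * (h - (m * ln s + n * ln t)).
Proof.
have nE : n = 1 - m by rewrite -mn addrC addKr.
by rewrite /y rp rq nE; ring.
Qed.

(** Young's inequality with weights [1/r] and [1 - 1/r] on [expR y] and [Z], whose weighted
    geometric mean is [X]; then [expR y <= Y] because [r - 1] is positive. *)
Lemma transport_ineq_gt1 : 1 < r -> X <= Y / r + (1 - r^-1) * Z.
Proof.
move=> r1; have rV : 0 <= r^-1 <= 1 by rewrite invr_ge0 (ltW r0)/= invf_le1// ltW.
apply: (@le_trans _ _ (r^-1 * expR y + (1 - r^-1) * Z)).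
  rewrite ZE; apply: le_trans (weighted_amgm_expR _ _ rV).
  rewrite XE ler_expR le_eqVlt; apply/orP; left; apply/eqP.
  by rewrite /y; field; rewrite gt_eqF.
rewrite lerD2r mulrC ler_pM2r ?invr_gt0// YE ler_expR -subr_ge0 yE.
by apply: mulr_ge0; rewrite subr_ge0; [exact: ltW|exact: hE].
Qed.

(** The roles change: with weights [r] and [1 - r] it is [X] and [Z] that have weighted geometric
    mean [expR y], and now [Y <= expR y] because [r - 1] is negative. *)
Lemma transport_ineq_lt1 : r < 1 -> Y / r <= X + (r^-1 - 1) * Z.
Proof.
move=> r1; rewrite ler_pdivrMr//.
apply: (@le_trans _ _ (expR y)).
  rewrite YE ler_expR -subr_le0 yE.
  by apply: mulr_le0_ge0; [rewrite subr_le0 ltW|rewrite subr_ge0; exact: hE].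
have rV : 0 <= r <= 1 by rewrite !ltW.
apply: (@le_trans _ _ (r * X + (1 - r) * Z)); last first.
  rewrite le_eqVlt; apply/orP; left; apply/eqP.
  by field; rewrite gt_eqF.
rewrite ZE XE; apply: le_trans (weighted_amgm_expR _ _ rV).
by rewrite ler_expR le_eqVlt; apply/orP; left; apply/eqP; rewrite /y; ring.
Qed.

End pointwise.

(** As [1/t' = 1 - 1/t], the factor [|t'|^(-1/t')] is [|1 - 1/t|^(1 - 1/t)]. The exponential form
    reduces identities between constants to linear ones between logarithms. *)
Lemma young_constE (R : realType) (t : R) : 0 < t -> t != 1 ->
  young_const t = expR (2^-1 * (t^-1 * ln t + (1 - t^-1) * ln `|1 - t^-1|)).
Proof.
move=> t0 t1; rewrite /young_const (negbTE t1).
have -> : fine (hoelder_conjugate t%:E) = (1 - t^-1)^-1.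
  rewrite /hoelder_conjugate/= eqe gt_eqF//.
  rewrite -EFinB inver subr_eq0 (negbTE t1) -EFinM/=.
  by field; rewrite subr_eq0 t1 gt_eqF.
have v0 : 0 < `|1 - t^-1|.
  by rewrite normr_gt0 subr_eq0 eq_sym invr_eq1.
rewrite invrK normfV -powR12_sqrt; last first.
  by rewrite divr_ge0 ?powR_ge0.
rewrite -{1}(lnK t0) -[X in X^-1 `^ _](lnK v0) -expRN !powR_expR -expRN -expRD.
by rewrite powR_expR; congr expR; ring.
Qed.

Lemma young_const1 (R : realType) : young_const 1 = 1 :> R.
Proof. by rewrite /young_const eqxx. Qed.

Lemma young_const_gt0 (R : realType) (t : R) : 0 < t -> 0 < young_const t.
Proof.
move=> t0; have [->|t1] := eqVneq t 1; first by rewrite young_const1.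
by rewrite young_constE// expR_gt0.
Qed.

(* The left-hand side collects the normalizations of the two Gaussians and the
   two Gaussian integrals produced by the transport argument. *)
Lemma young_const_identity (R : realType) (p q r m n : R) :
  0 < p -> 0 < q -> 0 < r -> 0 < m -> 0 < n -> m + n = 1 ->
  r / p = 1 + (r - 1) * n -> r / q = 1 + (r - 1) * m -> r != 1 ->
  Num.sqrt (p * n / pi) `^ p^-1 * Num.sqrt (q * m / pi) `^ q^-1 *
  (Num.sqrt (pi / (r * m * n)) `^ r^-1 * Num.sqrt pi) =
  young_const p * young_const q / young_const r.
Proof.
move=> p0 q0 r0 m0 n0 mn rp rq r1.
have pi0 : 0 < pi :> R by exact: pi_gt0.
(* In terms of conjugate exponents, [1/p' = m/r'] and [1/q' = n/r']. Hence [ln |1 - 1/p|] splits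
   into [ln |1 - 1/r| + ln m], and likewise for [q] with [n]. *)
have qE : 1 - p^-1 = (1 - r^-1) * m.
  have -> : p^-1 = (r / p) / r by field; rewrite !gt_eqF.
  have nE : n = 1 - m by rewrite -mn addrC addKr.
  by rewrite rp nE; field; rewrite gt_eqF.
have pE : 1 - q^-1 = (1 - r^-1) * n.
  have -> : q^-1 = (r / q) / r by field; rewrite !gt_eqF.
  have mE : m = 1 - n by rewrite -mn addrK.
  by rewrite rq mE; field; rewrite gt_eqF.
have r1' : 1 - r^-1 != 0.
  by rewrite subr_eq0 eq_sym invr_eq1.
have p1 : p != 1.
  have : 1 - p^-1 != 0 by rewrite qE mulf_neq0// gt_eqF.
  by rewrite subr_eq0 eq_sym invr_eq1.
have q1 : q != 1.
  have : 1 - q^-1 != 0 by rewrite pE mulf_neq0// gt_eqF.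
  by rewrite subr_eq0 eq_sym invr_eq1.
have sqrtE z : 0 < z -> Num.sqrt z = expR (2^-1 * ln z).
  by move=> z0; rewrite -powR12_sqrt ?(ltW z0)// -{1}(lnK z0) powR_expR.
rewrite !young_constE// !sqrtE ?divr_gt0 ?mulr_gt0//.
rewrite !powR_expR -expRN -!expRD; congr expR.
rewrite pE qE !normrM !(gtr0_norm m0) !(gtr0_norm n0).
have nr : 0 < `|1 - r^-1| by rewrite normr_gt0.
rewrite !(lnM, lnV) ?posrE ?invr_gt0 ?mulr_gt0//.
have pV : p^-1 = 1 - (1 - r^-1) * m by rewrite -qE opprB addrC subrK.
have qV : q^-1 = 1 - (1 - r^-1) * n by rewrite -pE opprB addrC subrK.
have nE : n = 1 - m by rewrite -mn addrC addKr.
rewrite pV qV.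
(* The logarithms become independent unknowns and only coefficients are compared. That of [ln pi]
   vanishes because [1/p + 1/q = 1 + 1/r]. *)
move: (ln p) (ln q) (ln r) (ln m) (ln n) (ln pi) (ln `|1 - r^-1|) => *.
by rewrite nE; field; rewrite gt_eqF.
Qed.

Section lconv.
Context (R : realType).
Local Notation lambda := (@lebesgue_measure R).
Local Open Scope ereal_scope.
Implicit Types f g : R -> \bar R.

Definition lconv f g (x : R) : \bar R := \int[lambda]_y (f (x - y)%R * g y).

Lemma lconv_ge0 f g x : (forall y, 0 <= f y) -> (forall y, 0 <= g y) ->
  0 <= lconv f g x.
Proof. by move=> f0 g0; apply: integral_ge0 => y _; exact: mule_ge0. Qed.

Lemma measurable_lconv_integrand f g :
  measurable_fun [set: R] f -> measurable_fun [set: R] g ->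
  measurable_fun [set: measurableTypeR R * measurableTypeR R]
    (fun z => f (z.1 - z.2)%R * g z.2).
Proof.
move=> mf mg; apply: emeasurable_funM.
  by apply: (measurableT_comp mf); exact: measurable_funB.
exact: (measurableT_comp mg).
Qed.

Lemma measurable_lconv f g :
  measurable_fun [set: R] f -> measurable_fun [set: R] g ->
  (forall y, 0 <= f y) -> (forall y, 0 <= g y) ->
  measurable_fun [set: R] (lconv f g).
Proof.
move=> mf mg f0 g0.
apply: (measurable_fun_fubini_tonelli_F
  (fun z : measurableTypeR R * measurableTypeR R => f (z.1 - z.2)%R * g z.2)).
  exact: measurable_lconv_integrand.
by move=> z; exact: mule_ge0.
Qed.

Lemma integral_gt0 (h : R -> R) : measurable_fun [set: R] h ->
  (forall x, 0 < h x)%R -> 0 < \int[lambda]_x (h x)%:E.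
Proof.
move=> mh h0; rewrite lt0e integral_ge0 ?andbT => [|x _]; last by rewrite lee_fin ltW.
apply/eqP => H.
have : ae_eq lambda setT (EFin \o h) (cst 0).
  apply/ae_eq_integral_abs => //; first exact/measurable_EFinP.
  rewrite -[RHS]H; apply: eq_integral => x _.
  by rewrite /= ger0_norm// ltW.
move=> [N [mN N0 sub]].
have NT : N = setT.
  apply/seteqP; split => // x _; apply: sub => /= /(_ I) hx.
  by have := h0 x; case: hx => ->; rewrite ltxx.
have := lebesgue_measure_itv (`[0%R, 1%R] : interval R).
rewrite /= lte_fin ltr01 oppr0 addr0.
have : lambda `[0%R, 1%R] <= lambda N.
  by apply: le_measure; rewrite ?inE ?NT//; exact: measurable_itv.
move: N0; rewrite /= => ->.
by move=> + L; rewrite L lee_fin leNgt ltr01.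
Qed.

End lconv.

Section lconv_gauss.
Context (R : realType).
Local Notation lambda := (@lebesgue_measure R).
Variables (f g : R -> R) (A : R).
Hypotheses (mf : measurable_fun [set: R] f) (mg : measurable_fun [set: R] g).
Hypotheses (f0 : forall x, 0 <= f x) (g0 : forall x, 0 <= g x).
Hypothesis fA : forall x, f x <= A * expR (- x ^+ 2).
Hypothesis gA : forall x, g x <= A * expR (- x ^+ 2).

(** Completing the square gives [(x - y)^2 + y^2 = x^2 / 2 + 2 (y - x / 2)^2]; the integral in [y]
    of the second Gaussian is [sqrt (pi / 2)]. *)
Lemma lconv_gauss_le x : (lconv (EFin \o f) (EFin \o g) x <=
  (A ^+ 2 * Num.sqrt (pi / 2) * expR (- (2^-1 * x ^+ 2)))%:E)%E.
Proof.
pose h y := A ^+ 2 * expR (- (2^-1 * x ^+ 2)) * expR (- (2 * (y - x / 2) ^+ 2)).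
have mh : measurable_fun [set: R] h.
  by apply: measurable_funM => //; exact: measurable_gauss_scale.
apply: (@le_trans _ _ (\int[lambda]_y (h y)%:E)%E).
  apply: ge0_le_integral => //.
  - by move=> y _; rewrite /= lee_fin mulr_ge0.
  - apply: emeasurable_funM; last by apply/measurable_EFinP; exact: mg.
    apply/measurable_EFinP; apply: (measurableT_comp mf).
    exact: measurable_funB.
  - exact/measurable_EFinP.
  - move=> y _; rewrite lee_fin.
    have H : f (x - y) * g y <=
        (A * expR (- (x - y) ^+ 2)) * (A * expR (- y ^+ 2)).
      by apply: ler_pM.
    apply: (le_trans H); rewrite le_eqVlt; apply/orP; left; apply/eqP.
    rewrite mulrACA -expr2 -expRD /h -mulrA -expRD; congr (_ * expR _).
    by field.
rewrite (_ : (fun y => (h y)%:E) = (fun y => (A ^+ 2 * expR (- (2^-1 * x ^+ 2)))%:E *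
    (expR (- (2 * (y - x / 2) ^+ 2)))%:E)%E); last by apply/funext.
rewrite ge0_integralZl//.
- rewrite integral_gauss_scale// -EFinM lee_fin le_eqVlt; apply/orP; left.
  by apply/eqP; ring.
- by apply/measurable_EFinP; exact: measurable_gauss_scale.
- by rewrite lee_fin mulr_ge0 ?expR_ge0 ?sqr_ge0.
Qed.

End lconv_gauss.

Local Lemma mulfC_div (R : fieldType) (x y z : R) : x * (y / z) = x / z * y.
Proof. by ring. Qed.

Section core.
Context (R : realType).
Local Notation lambda := (@lebesgue_measure R).
Variables (p q r m n : R).
Hypotheses (p0 : 0 < p) (q0 : 0 < q) (r0 : 0 < r) (m0 : 0 < m) (n0 : 0 < n).
Hypothesis mn : m + n = 1.
Hypothesis rp : r / p = 1 + (r - 1) * n.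
Hypothesis rq : r / q = 1 + (r - 1) * m.
Variables (f g : R -> R) (A : R).
Hypotheses (cf : continuous f) (cg : continuous g).
Hypotheses (f0 : forall x, 0 < f x) (g0 : forall x, 0 < g x).
Hypothesis fA : forall x, f x <= A * expR (- x ^+ 2).
Hypothesis gA : forall x, g x <= A * expR (- x ^+ 2).

Let W := lconv (EFin \o f) (EFin \o g).
Let w x := fine (W x).
Let D := A ^+ 2 * Num.sqrt (pi / 2).

Local Lemma mf : measurable_fun [set: R] f.
Proof. exact: continuous_measurable_fun. Qed.

Local Lemma mg : measurable_fun [set: R] g.
Proof. exact: continuous_measurable_fun. Qed.

Local Lemma W_le x : (W x <= (D * expR (- (2^-1 * x ^+ 2)))%:E)%E.
Proof.
by apply: lconv_gauss_le => // [||y|y]; [exact: mf|exact: mg|exact: ltW|exact: ltW].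
Qed.

Lemma fine_lconv x : W x = (w x)%:E.
Proof.
rewrite fineK// ge0_fin_numE; first exact: le_lt_trans (W_le x) (ltry _).
by apply: lconv_ge0 => y; rewrite lee_fin ltW.
Qed.

Local Lemma w_gt0 x : 0 < w x.
Proof.
rewrite -lte_fin -fine_lconv; apply: integral_gt0 => [|y]; last by rewrite mulr_gt0.
apply: measurable_funM; last exact: mg.
by apply: (measurableT_comp mf); exact: measurable_funB.
Qed.

Local Lemma mW : measurable_fun [set: R] W.
Proof.
apply: measurable_lconv => [| |y|y]; rewrite ?lee_fin ?ltW//.
- by apply/measurable_EFinP; exact: mf.
- by apply/measurable_EFinP; exact: mg.
Qed.

Local Lemma mw : measurable_fun [set: R] w.
Proof. by apply: measurableT_comp => //; exact: mW. Qed.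

Local Lemma mwr x : measurable_fun [set: R] (fun t => w t `^ x).
Proof. by apply: (@measurableT_comp _ _ _ _ _ _ (@powR R ^~ x)) => //; exact: mw. Qed.

Let omega := fine (\int[lambda]_x (w x `^ r)%:E)%E.

(** Finiteness of [omega], from the Gaussian bound on [w]. It licenses the final cancellation of a
    power of [omega]. *)
Lemma fine_integral_lconv_powR : (\int[lambda]_x (w x `^ r)%:E = omega%:E)%E.
Proof.
rewrite fineK// ge0_fin_numE; last first.
  by apply: integral_ge0 => x _; rewrite lee_fin powR_ge0.
have D0 : 0 <= D by rewrite mulr_ge0 ?sqr_ge0 ?sqrtr_ge0.
apply: (@le_lt_trans _ _ (\int[lambda]_x ((D `^ r)%:E *
    (expR (- (r / 2 * (x - 0) ^+ 2)))%:E))%E).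
  apply: ge0_le_integral => //.
  - by move=> x _; rewrite lee_fin powR_ge0.
  - by apply/measurable_EFinP; exact: mwr.
  - apply: emeasurable_funM => //.
    by apply/measurable_EFinP; exact: measurable_gauss_scale.
  - move=> x _; rewrite -EFinM lee_fin.
    have H : w x <= D * expR (- (2^-1 * x ^+ 2)) by rewrite -lee_fin -fine_lconv W_le.
    have := @ge0_ler_powR _ r (ltW r0) (w x) _ _ _ H.
    rewrite !nnegrE (ltW (w_gt0 x)) mulr_ge0 ?expR_ge0// => /(_ isT isT) H'.
    apply: (le_trans H'); rewrite powRM ?expR_ge0// powR_expR.
    rewrite le_eqVlt; apply/orP; left; apply/eqP; congr (_ * expR _).
    by rewrite subr0; field.
rewrite ge0_integralZl//.
- by rewrite integral_gauss_scale ?divr_gt0// -EFinM ltry.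
- by apply/measurable_EFinP; exact: measurable_gauss_scale.
- by rewrite lee_fin powR_ge0.
Qed.

Local Lemma omega_gt0 : 0 < omega.
Proof.
rewrite -lte_fin -fine_integral_lconv_powR; apply: integral_gt0; first exact: mwr.
by move=> x; rewrite powR_gt0// w_gt0.
Qed.

(** One factor of [w^r = w * w^(r-1)] is opened as the convolution integral; the other is carried
    along as a weight. *)
Local Lemma omega_iterated :
  (omega%:E = \int[lambda]_x \int[lambda]_y (f (x - y) * g y * w x `^ (r - 1))%:E)%E.
Proof.
rewrite -fine_integral_lconv_powR; apply: eq_integral => x _.
have -> : w x `^ r = w x * w x `^ (r - 1).
  rewrite -{2}(powRr1 (ltW (w_gt0 x))) -powRD.
    by rewrite addrC subrK.
  by rewrite (gt_eqF (w_gt0 x)) implybT.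
rewrite EFinM -fine_lconv /W /lconv -ge0_integralZr//.
- apply: emeasurable_funM; last by apply/measurable_EFinP; exact: mg.
  apply/measurable_EFinP; apply: (measurableT_comp mf).
  exact: measurable_funB.
- by move=> y _; rewrite /= lee_fin mulr_ge0 ?ltW.
- by rewrite lee_fin powR_ge0.
Qed.

Variables (a b : R) (S s U u : R -> R).
Hypotheses (a0 : 0 < a) (b0 : 0 < b).
Hypothesis dS : forall x : R, is_derive x 1 S (s x).
Hypothesis dU : forall x : R, is_derive x 1 U (u x).
Hypotheses (cs : continuous s) (cu : continuous u).
Hypotheses (s0 : forall x, 0 < s x) (u0 : forall x, 0 < u x).
Hypothesis ontoS : forall y, exists x, S x = y.
Hypothesis ontoU : forall y, exists x, U x = y.

Let F x := a * expR (- (p * n * x ^+ 2)).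
Let G x := b * expR (- (q * m * x ^+ 2)).
Hypothesis FE : forall x, F x = f (S x) `^ p * s x.
Hypothesis GE : forall x, G x = g (U x) `^ q * u x.

Let c := a `^ (r / p) * b `^ (r / q).
Let kappa := Num.sqrt (pi / (r * m * n)).
Let alpha Q := c * expR (- (r * Q ^+ 2)) * kappa.

(** The Gaussian exponents [p n] and [q m] are chosen for this separation: as [m + n = 1], the cross
    terms of [n (m P - Q)^2 + m (Q + n P)^2] cancel and [m n P^2 + Q^2] remains. *)
Local Lemma FGE Q P : F (m * P - Q) `^ (r / p) * G (Q + n * P) `^ (r / q) =
  c * expR (- (r * Q ^+ 2)) * expR (- (r * m * n * (P - 0) ^+ 2)).
Proof.
rewrite /F /G !powRM ?expR_ge0 ?(ltW a0) ?(ltW b0)// !powR_expR mulrACA.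
rewrite -expRD -[RHS]mulrA -[in RHS]expRD; congr (_ * expR _).
have nE : n = 1 - m by rewrite -mn addrC addKr.
by rewrite nE; field; rewrite !gt_eqF.
Qed.

Local Lemma c_gt0 : 0 < c.
Proof. by rewrite mulr_gt0 ?powR_gt0. Qed.

Local Lemma kappa_gt0 : 0 < kappa.
Proof. by rewrite sqrtr_gt0 divr_gt0 ?pi_gt0 ?mulr_gt0. Qed.

Local Lemma alpha_gt0 Q : 0 < alpha Q.
Proof.
apply: mulr_gt0; last exact: kappa_gt0.
by apply: mulr_gt0; [exact: c_gt0|exact: expR_gt0].
Qed.

Local Lemma integral_FG Q :
  (\int[lambda]_P (F (m * P - Q) `^ (r / p) * G (Q + n * P) `^ (r / q))%:E =
   (alpha Q)%:E)%E.
Proof.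
under eq_integral do rewrite FGE EFinM.
rewrite ge0_integralZl//.
- by rewrite integral_gauss_scale ?mulr_gt0// -EFinM.
- by apply/measurable_EFinP; exact: measurable_gauss_scale.
- by rewrite lee_fin mulr_ge0 ?expR_ge0 ?ltW ?c_gt0.
Qed.

Local Lemma measurable_FG Q : measurable_fun [set: R]
  (fun P => F (m * P - Q) `^ (r / p) * G (Q + n * P) `^ (r / q)).
Proof.
rewrite (_ : (fun P => _) = (fun P =>
  c * expR (- (r * Q ^+ 2)) * expR (- (r * m * n * (P - 0) ^+ 2)))).
  by apply: measurable_funM => //; exact: measurable_gauss_scale.
by apply/funext => P; exact: FGE.
Qed.

Let x_ Q P := S (m * P - Q) + U (Q + n * P).
Let theta Q P := m * s (m * P - Q) + n * u (Q + n * P).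

Local Lemma dx (Q P : R) : is_derive P 1 (x_ Q) (theta Q P).
Proof.
have d1 : is_derive P 1 (fun P : R => m * P - Q) m.
  have := is_deriveB (is_deriveZ m (is_derive_id P 1)) (is_derive_cst Q P 1).
  by rewrite /GRing.scale/= mulr1 subr0.
have d2 : is_derive P 1 (fun P : R => Q + n * P) n.
  have := is_deriveD (is_derive_cst Q P 1) (is_deriveZ n (is_derive_id P 1)).
  by rewrite /GRing.scale/= mulr1 add0r.
have D1 := @is_derive1_comp R S (fun P : R => m * P - Q) P _ _ (dS _) d1.
have D2 := @is_derive1_comp R U (fun P : R => Q + n * P) P _ _ (dU _) d2.
by have := is_deriveD D1 D2; rewrite mulrC [u _ * _]mulrC.
Qed.

Local Lemma ctheta Q : continuous (theta Q).
Proof.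
have c1 : continuous (fun P : R => m * P - Q).
  by move=> P; apply: cvgB; [apply: cvgM; [exact: cvg_cst|exact: cvg_id]|exact: cvg_cst].
have c2 : continuous (fun P : R => Q + n * P).
  by move=> P; apply: cvgD; [exact: cvg_cst|apply: cvgM; [exact: cvg_cst|exact: cvg_id]].
move=> P; apply: cvgD; apply: cvgM; try exact: cvg_cst.
- by apply: (@continuous_comp _ _ _ (fun P => m * P - Q) s); [exact: c1|exact: cs].
- by apply: (@continuous_comp _ _ _ (fun P => Q + n * P) u); [exact: c2|exact: cu].
Qed.

Local Lemma theta_gt0' Q P : 0 < theta Q P.
Proof. by rewrite addr_gt0// mulr_gt0. Qed.

(** With [S i = U j = y / 2], consider the solutions [P] of [m P - Q = i] and of [Q + n P = j]. At
    the smaller one both summands are at most [y / 2], at the larger one at least [y / 2], and the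
    intermediate value theorem applies. *)
Local Lemma onto_x Q y : exists P, x_ Q P = y.
Proof.
have leS x z : (S x <= S z) = (x <= z) by rewrite !leNgt (C1_lt dS s0).
have leU x z : (U x <= U z) = (x <= z) by rewrite !leNgt (C1_lt dU u0).
have [i Si] := ontoS (y / 2); have [j Uj] := ontoU (y / 2).
pose P1 := Num.min ((i + Q) / m) ((j - Q) / n).
pose P2 := Num.max ((i + Q) / m) ((j - Q) / n).
have P12 : P1 <= P2 by rewrite /P1 /P2 ge_min le_max lexx.
have l1 : x_ Q P1 <= y.
  rewrite [leRHS]splitr -{1}Si -Uj lerD//.
    rewrite leS lerBlDr mulrC -ler_pdivlMr//.
    by rewrite ge_min lexx.
  rewrite leU addrC -lerBrDr mulrC -ler_pdivlMr//.
  by rewrite ge_min lexx orbT.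
have l2 : y <= x_ Q P2.
  rewrite [leLHS]splitr -{1}Si -Uj lerD//.
    rewrite leS lerBrDr mulrC -ler_pdivrMr//.
    by rewrite le_max lexx.
  rewrite leU -lerBlDl mulrC -ler_pdivrMr//.
  by rewrite le_max lexx orbT.
have [||P _ Py] := @IVT _ (x_ Q) P1 P2 y P12.
- by apply: continuous_subspaceT; exact: (C1_continuous (dx Q)).
- by rewrite ge_min l1/= le_max l2 orbT.
by exists P.
Qed.

(** For each [Q] the increasing bijection [x_ Q] has derivative [theta Q], so substitution returns
    the integral of [w^r], independently of [Q]. The estimate thereby closes on [omega]. *)
Local Lemma integral_theta Q :
  (\int[lambda]_P (theta Q P * w (x_ Q P) `^ r)%:E = omega%:E)%E.
Proof.
rewrite -fine_integral_lconv_powR [RHS](ge0_integral_subst (dx Q) (@ctheta Q) (theta_gt0' Q) (onto_x Q)).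
- by apply: eq_integral => P _; rewrite -EFinM mulrC.
- by apply/measurable_EFinP; exact: mwr.
- by move=> y; rewrite lee_fin powR_ge0.
Qed.

Let X Q P := f (S (m * P - Q)) * g (U (Q + n * P)) *
  (s (m * P - Q) * u (Q + n * P)) * w (x_ Q P) `^ (r - 1).

Local Lemma omega_X : (omega%:E = \int[lambda]_Q \int[lambda]_P (X Q P)%:E)%E.
Proof.
pose H (z : measurableTypeR R * measurableTypeR R) :=
  (f (z.1 - z.2) * g z.2 * w z.1 `^ (r - 1))%:E.
have mH : measurable_fun setT H.
  apply/measurable_EFinP; apply: measurable_funM.
    apply: measurable_funM; last exact: (measurableT_comp mg).
    by apply: (measurableT_comp mf); exact: measurable_funB.
  exact: (measurableT_comp (mwr _)).
have H0 z : (0 <= H z)%E.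
  by rewrite lee_fin !mulr_ge0 ?powR_ge0//; exact: ltW.
rewrite omega_iterated.
apply: (etrans (ge0_integral2_change dS dU cs cu s0 u0 ontoS ontoU mn mH H0)).
apply: eq_integral => Q _; apply: eq_integral => P _.
by rewrite /H/= -EFinM /X /x_ addrK; congr EFin; rewrite mulrAC.
Qed.

Local Lemma mX2 : measurable_fun [set: measurableTypeR R * measurableTypeR R]
  (fun z => X z.1 z.2).
Proof.
have m1 : measurable_fun [set: measurableTypeR R * measurableTypeR R]
    (fun z => m * z.2 - z.1).
  by apply: measurable_funB => //; exact: measurable_funM.
have m2 : measurable_fun [set: measurableTypeR R * measurableTypeR R]
    (fun z => z.1 + n * z.2).
  by apply: measurable_funD => //; exact: measurable_funM.
have mS1 := measurableT_comp (C1_measurable dS) m1.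
have mU1 := measurableT_comp (C1_measurable dU) m2.
apply: measurable_funM; last first.
  by apply: (measurableT_comp (mwr _)); exact: measurable_funD.
apply: measurable_funM; apply: measurable_funM.
- exact: (measurableT_comp mf).
- exact: (measurableT_comp mg).
- by apply: (@measurableT_comp _ _ _ _ _ _ s) => //; exact: continuous_measurable_fun.
- by apply: (@measurableT_comp _ _ _ _ _ _ u) => //; exact: continuous_measurable_fun.
Qed.

Local Lemma mX Q : measurable_fun [set: R] (X Q).
Proof. exact: (measurableT_comp mX2 (measurable_fun_pair _ _)). Qed.

Local Lemma X_ge0 Q P : 0 <= X Q P.
Proof. by rewrite !mulr_ge0 ?powR_ge0// ltW. Qed.

Local Lemma mintX : measurable_fun [set: R] (fun Q => \int[lambda]_P (X Q P)%:E)%E.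
Proof.
apply: (measurable_fun_fubini_tonelli_F
  (fun z : measurableTypeR R * measurableTypeR R => (X z.1 z.2)%:E)).
  by apply/measurable_EFinP; exact: mX2.
by move=> z; rewrite lee_fin X_ge0.
Qed.

(** Balances the two integrated terms: [tau^(r-1) * alpha = omega / tau], so their combination with
    weights [1/r] and [1 - 1/r] is the common value [alpha^(1/r) * omega^(1-1/r)]. It depends on [Q]
    alone, hence is constant in the integral over [P]. *)
Let tau Q := (omega / alpha Q) `^ r^-1.

Local Lemma tau_gt0 Q : 0 < tau Q.
Proof. by rewrite powR_gt0// divr_gt0 ?omega_gt0 ?alpha_gt0. Qed.

Local Lemma tauE Q :
  tau Q `^ (r - 1) / r * alpha Q + (1 - r^-1) * (omega / tau Q) =
  alpha Q `^ r^-1 * omega `^ (1 - r^-1).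
Proof.
have := alpha_gt0 Q; have := omega_gt0; rewrite /tau.
move: (alpha Q) omega => al om om0 al0.
rewrite -(lnK om0) -(lnK al0) -expRN -expRD !powR_expR -expRN -!expRD.
rewrite mulrAC -expRD.
have -> : (r - 1) * (r^-1 * (ln om - ln al)) + ln al =
    r^-1 * ln al + (1 - r^-1) * ln om by field; rewrite gt_eqF.
have -> : ln om - r^-1 * (ln om - ln al) =
    r^-1 * ln al + (1 - r^-1) * ln om by field; rewrite gt_eqF.
by field; rewrite gt_eqF.
Qed.

Let Y Q P := tau Q `^ (r - 1) / r *
  (F (m * P - Q) `^ (r / p) * G (Q + n * P) `^ (r / q)).
Let Z Q P := theta Q P * w (x_ Q P) `^ r.

Local Lemma measurable_Y Q : measurable_fun [set: R] (Y Q).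
Proof. by apply: measurable_funM => //; exact: measurable_FG. Qed.

Local Lemma measurable_Z Q : measurable_fun [set: R] (Z Q).
Proof.
apply: measurable_funM.
  by apply: continuous_measurable_fun; exact: ctheta.
by apply: (measurableT_comp (mwr r)); exact: (C1_measurable (dx Q)).
Qed.

Local Lemma Y_ge0 Q P : 0 <= Y Q P.
Proof.
apply: mulr_ge0; first by rewrite divr_ge0 ?powR_ge0 ?ltW.
by rewrite mulr_ge0 ?powR_ge0.
Qed.

Local Lemma Z_ge0 Q P : 0 <= Z Q P.
Proof. by apply: mulr_ge0; rewrite ?powR_ge0 ?ltW ?theta_gt0'. Qed.

Local Lemma integral_Y Q :
  (\int[lambda]_P (Y Q P)%:E = (tau Q `^ (r - 1) / r * alpha Q)%:E)%E.
Proof.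
under eq_integral do rewrite EFinM.
rewrite ge0_integralZl//.
- by rewrite integral_FG -EFinM.
- by apply/measurable_EFinP; exact: measurable_FG.
- by move=> P _; rewrite lee_fin mulr_ge0 ?powR_ge0.
- by rewrite lee_fin divr_ge0 ?powR_ge0 ?ltW.
Qed.

Local Lemma integral_kZ k Q : 0 <= k ->
  (\int[lambda]_P (k * Z Q P)%:E = (k * omega)%:E)%E.
Proof.
move=> k0; under eq_integral do rewrite EFinM.
rewrite ge0_integralZl//.
- by rewrite integral_theta -EFinM.
- by apply/measurable_EFinP; exact: measurable_Z.
- by move=> P _; rewrite lee_fin Z_ge0.
Qed.

Local Lemma inner_gt1 Q : 1 < r ->
  (\int[lambda]_P (X Q P)%:E <= (alpha Q `^ r^-1 * omega `^ (1 - r^-1))%:E)%E.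
Proof.
move=> r1; rewrite -tauE.
have k0 : 0 <= (1 - r^-1) / tau Q.
  by rewrite divr_ge0 ?subr_ge0 ?invf_le1// ltW ?tau_gt0.
have -> : (1 - r^-1) * (omega / tau Q) = (1 - r^-1) / tau Q * omega by ring.
rewrite EFinD -integral_Y.
rewrite -(integral_kZ Q k0) -ge0_integralD//; last 4 first.
- by move=> P _; rewrite lee_fin Y_ge0.
- by apply/measurable_EFinP; exact: measurable_Y.
- by move=> P _; rewrite lee_fin mulr_ge0 ?Z_ge0.
- by apply/measurable_EFinP; apply: measurable_funM => //; exact: measurable_Z.
apply: ge0_le_integral => //.
- by move=> P _; rewrite lee_fin X_ge0.
- by apply/measurable_EFinP; exact: mX.
- apply/measurable_EFinP; apply: measurable_funD; first exact: measurable_Y.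
  by apply: measurable_funM => //; exact: measurable_Z.
- move=> P _; rewrite -EFinD lee_fin.
  have := transport_ineq_gt1 p0 q0 r0 m0 n0 mn rp rq (f0 (S (m * P - Q)))
    (g0 (U (Q + n * P))) (s0 (m * P - Q)) (u0 (Q + n * P)) (w_gt0 (x_ Q P))
    (tau_gt0 Q) r1.
  rewrite -FE -GE => H; apply: (le_trans H); rewrite [X in X + _]mulrAC.
  by rewrite mulfC_div.
Qed.

Local Lemma inner_lt1 Q : r < 1 ->
  ((alpha Q `^ r^-1 * omega `^ (1 - r^-1))%:E <= \int[lambda]_P (X Q P)%:E)%E.
Proof.
move=> r1; rewrite -tauE.
have k0 : 0 <= (r^-1 - 1) / tau Q.
  by rewrite divr_ge0 ?subr_ge0 ?invf_ge1 ?ltW// tau_gt0.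
(* The second coefficient is negative for [r < 1]; its finite integral goes to the other side, which
   leaves only nonnegative integrands. *)
have -> : tau Q `^ (r - 1) / r * alpha Q + (1 - r^-1) * (omega / tau Q) =
  tau Q `^ (r - 1) / r * alpha Q - (r^-1 - 1) / tau Q * omega by ring.
rewrite EFinB -integral_Y leeBlDr//.
rewrite -(integral_kZ Q k0) -ge0_integralD//; last 4 first.
- by move=> P _; rewrite lee_fin X_ge0.
- by apply/measurable_EFinP; exact: mX.
- by move=> P _; rewrite lee_fin mulr_ge0 ?Z_ge0.
- by apply/measurable_EFinP; apply: measurable_funM => //; exact: measurable_Z.
apply: ge0_le_integral => //.
- by move=> P _; rewrite lee_fin Y_ge0.
- by apply/measurable_EFinP; exact: measurable_Y.
- apply/measurable_EFinP; apply: measurable_funD; first exact: mX.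
  by apply: measurable_funM => //; exact: measurable_Z.
- move=> P _; rewrite -EFinD lee_fin.
  have := transport_ineq_lt1 p0 q0 r0 m0 n0 mn rp rq (f0 (S (m * P - Q)))
    (g0 (U (Q + n * P))) (s0 (m * P - Q)) (u0 (Q + n * P)) (w_gt0 (x_ Q P))
    (tau_gt0 Q) r1.
  rewrite -FE -GE mulrAC => H; apply: (le_trans H).
  by rewrite mulfC_div.
Qed.

Local Lemma alpha_powE Q : alpha Q `^ r^-1 * omega `^ (1 - r^-1) =
  omega `^ (1 - r^-1) * (c * kappa) `^ r^-1 * expR (- (1 * (Q - 0) ^+ 2)).
Proof.
rewrite -mulrA [RHS]mulrC; congr (_ * _).
have ck0 : 0 <= c * kappa.
  by apply: mulr_ge0; [exact: ltW c_gt0|exact: ltW kappa_gt0].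
rewrite /alpha [c * _ * kappa]mulrAC (powRM _ ck0 (expR_ge0 _)) powR_expR.
by congr (_ * expR _); field; rewrite gt_eqF.
Qed.

Local Lemma integral_alpha :
  (\int[lambda]_Q (alpha Q `^ r^-1 * omega `^ (1 - r^-1))%:E =
   (omega `^ (1 - r^-1) * ((c * kappa) `^ r^-1 * Num.sqrt pi))%:E)%E.
Proof.
under eq_integral do rewrite alpha_powE EFinM.
rewrite ge0_integralZl//.
- by rewrite integral_gauss_scale// -EFinM divr1 mulrA.
- by apply/measurable_EFinP; exact: measurable_gauss_scale.
- by rewrite lee_fin mulr_ge0 ?powR_ge0.
Qed.

Local Lemma measurable_alpha :
  measurable_fun [set: R] (fun Q => alpha Q `^ r^-1 * omega `^ (1 - r^-1)).
Proof.
under eq_fun do rewrite alpha_powE.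
by apply: measurable_funM => //; exact: measurable_gauss_scale.
Qed.

Local Lemma omega_split : omega = omega `^ (1 - r^-1) * omega `^ r^-1.
Proof.
rewrite -powRD; first by rewrite subrK powRr1// ltW// omega_gt0.
by rewrite (gt_eqF omega_gt0) implybT.
Qed.

(** Integrating [inner_gt1] in [Q] bounds [omega] by [omega^(1-1/r)] times the right-hand side; the
    factor [omega^(1-1/r)], finite and positive, cancels. *)
Lemma core_gt1 : 1 < r -> omega `^ r^-1 <= (c * kappa) `^ r^-1 * Num.sqrt pi.
Proof.
move=> r1; have o0 : 0 < omega `^ (1 - r^-1) by rewrite powR_gt0// omega_gt0.
rewrite -(ler_pM2l o0) -omega_split -lee_fin -integral_alpha omega_X.
apply: ge0_le_integral => //.
- by move=> Q _; apply: integral_ge0 => P _; rewrite lee_fin X_ge0.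
- exact: mintX.
- by apply/measurable_EFinP; exact: measurable_alpha.
- by move=> Q _; exact: inner_gt1.
Qed.

Lemma core_lt1 : r < 1 -> (c * kappa) `^ r^-1 * Num.sqrt pi <= omega `^ r^-1.
Proof.
move=> r1; have o0 : 0 < omega `^ (1 - r^-1) by rewrite powR_gt0// omega_gt0.
rewrite -(ler_pM2l o0) -omega_split -lee_fin -integral_alpha omega_X.
apply: ge0_le_integral => //.
- by move=> Q _; rewrite lee_fin mulr_ge0 ?powR_ge0.
- by apply/measurable_EFinP; exact: measurable_alpha.
- exact: mintX.
- by move=> Q _; exact: inner_lt1.
Qed.

End core.

Section gaussian_dominated.
Context (R : realType).
Local Notation lambda := (@lebesgue_measure R).

Lemma continuous_powR_pos (f : R -> R) (p : R) : continuous f ->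
  (forall x, 0 < f x) -> continuous (fun x => f x `^ p).
Proof.
move=> cf f0; have -> : (fun x => f x `^ p) = (fun x => expR (p * ln (f x))).
  by apply/funext => x; rewrite -powR_expR lnK// posrE.
have c1 : continuous (fun x => ln (f x)).
  by move=> x; apply: (@continuous_comp _ _ _ f (@ln R)); [exact: cf|exact: continuous_ln].
have c2 : continuous (fun x => p * ln (f x)).
  by move=> x; apply: cvgM; [exact: cvg_cst|exact: c1].
have c3 : continuous (expR \o (fun x => p * ln (f x))).
  by move=> x; apply: continuous_comp; [exact: c2|exact: continuous_expR].
exact: c3.
Qed.

Lemma integrable_powR_gauss (f : R -> R) (A p : R) : 0 < p ->
  measurable_fun [set: R] f -> (forall x, 0 <= f x) ->
  (forall x, f x <= A * expR (- x ^+ 2)) ->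
  lambda.-integrable [set: R] (fun x => (f x `^ p)%:E).
Proof.
move=> p0 mf f0 fA.
have A0 : 0 <= A by have := le_trans (f0 0) (fA 0); rewrite pmulr_lge0 ?expR_gt0.
have mfp : measurable_fun [set: R] (fun x => f x `^ p).
  by apply: (@measurableT_comp _ _ _ _ _ _ (@powR R ^~ p)).
apply: (@le_integrable _ _ _ lambda _ measurableT _
  (fun x => ((A `^ p)%:E * (expR (- (p * (x - 0) ^+ 2)))%:E)%E)).
- exact/measurable_EFinP.
- move=> x _; rewrite !gee0_abs ?mule_ge0 ?lee_fin ?powR_ge0 ?expR_ge0//.
  rewrite subr0; have := @ge0_ler_powR _ p (ltW p0) (f x) (A * expR (- x ^+ 2)).
  rewrite !nnegrE f0 mulr_ge0 ?expR_ge0// => /(_ isT isT (fA x)).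
  by rewrite powRM ?expR_ge0// powR_expR mulrN.
- by apply: integrableZl => //; exact: integrable_gauss_scale.
Qed.

Variables (p q r : R).
Hypotheses (p0 : 0 < p) (q0 : 0 < q) (r0 : 0 < r).
Hypothesis pqr : p^-1 + q^-1 = 1 + r^-1.
Let K := young_const p * young_const q / young_const r.

Variables (f g : R -> R) (A : R).
Hypotheses (cf : continuous f) (cg : continuous g).
Hypotheses (f0 : forall x, 0 < f x) (g0 : forall x, 0 < g x).
Hypothesis fA : forall x, f x <= A * expR (- x ^+ 2).
Hypothesis gA : forall x, g x <= A * expR (- x ^+ 2).

(** [Num.sqrt (d / pi)] normalizes the Gaussian to mass one, so [a] gives it the mass [phi] of
    [h^k], as monotone transport requires. *)
Local Lemma gauss_transport (h : R -> R) (k d : R) : 0 < k -> 0 < d ->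
  continuous h -> (forall x, 0 < h x) ->
  (forall x, h x <= A * expR (- x ^+ 2)) ->
  let phi := fine (\int[lambda]_x (h x `^ k)%:E)%E in
  let a := phi * Num.sqrt (d / pi) in
  [/\ 0 < phi, 0 < a, (\int[lambda]_x (h x `^ k)%:E = phi%:E)%E &
  exists S s : R -> R, [/\ forall x : R, is_derive x 1 S (s x), continuous s,
    forall x, 0 < s x, forall y, exists x, S x = y &
    forall x, a * expR (- (d * x ^+ 2)) = h (S x) `^ k * s x]].
Proof.
move=> k0 d0 ch h0 hA phi a.
have mh : measurable_fun [set: R] h by exact: continuous_measurable_fun.
have ih := integrable_powR_gauss k0 mh (fun x => ltW (h0 x)) hA.
have phiE : (\int[lambda]_x (h x `^ k)%:E = phi%:E)%E.
  by rewrite fineK// integrable_fin_num.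
have phi0 : 0 < phi.
  rewrite -lte_fin -phiE; apply: integral_gt0 => [|x]; last exact: powR_gt0.
  by apply: (@measurableT_comp _ _ _ _ _ _ (@powR R ^~ k)).
have dpi0 : 0 < Num.sqrt (d / pi) by rewrite sqrtr_gt0 divr_gt0// pi_gt0.
have a0 : 0 < a by rewrite mulr_gt0.
have FE x : a * expR (- (d * x ^+ 2)) = a * expR (- (d * (x - 0) ^+ 2)) by rewrite subr0.
have iF : (\int[lambda]_x (a * expR (- (d * x ^+ 2)))%:E = phi%:E)%E.
  under eq_integral do rewrite FE EFinM.
  rewrite ge0_integralZl//.
  - rewrite integral_gauss_scale// -EFinM /a -mulrA -sqrtrM ?divr_ge0 ?pi_ge0 ?(ltW d0)//.
    have -> : d / pi * (pi / d) = 1 by rewrite -[d / pi]invf_div mulVf ?gt_eqF ?divr_gt0 ?pi_gt0.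
    by rewrite sqrtr1 mulr1.
  - by apply/measurable_EFinP; exact: measurable_gauss_scale.
  - by rewrite lee_fin ltW.
split => //; apply: (@monotone_transport R _ (fun x => h x `^ k)).
- have c1 : continuous (fun x : R => - (d * x ^+ 2)).
    move=> x; apply: cvgN; apply: cvgM; first exact: cvg_cst.
    exact: exprn_continuous.
  have c2 : continuous (expR \o (fun x : R => - (d * x ^+ 2))).
    by move=> x; apply: continuous_comp; [exact: c1|exact: continuous_expR].
  by move=> x; apply: cvgM; [exact: cvg_cst|exact: c2].
- exact: continuous_powR_pos.
- by move=> x; rewrite mulr_gt0 ?expR_gt0.
- by move=> x; rewrite powR_gt0.
- apply: eq_integrable (integrableZl _ a (integrable_gauss_scale 0 d0)) => //.
  by move=> x _; rewrite /= -EFinM FE.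
- exact: ih.
- by rewrite /Rintegral iF phiE.
Qed.

Let Wr := pnorm lambda r (lconv (EFin \o f) (EFin \o g)).
Let RHS := (K%:E * pnorm lambda p (EFin \o f) * pnorm lambda q (EFin \o g))%E.

Lemma young_gaussian_dominated :
  (1 < p -> 1 < q -> 1 < r -> (Wr <= RHS)%E) /\
  (p < 1 -> q < 1 -> r < 1 -> (RHS <= Wr)%E).
Proof.
(* These quotients are [n] and [m]. Numerator and denominator are both positive when all exponents
   exceed [1] and both negative when all are below [1], so one argument serves the two cases. *)
suff H : 0 < (1 - q^-1) / (1 - r^-1) -> 0 < (1 - p^-1) / (1 - r^-1) -> r != 1 ->
    (1 < r -> (Wr <= RHS)%E) /\ (r < 1 -> (RHS <= Wr)%E).
  split => p1 q1 r1.
    apply H => //; last by rewrite gt_eqF.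
    - by rewrite divr_gt0// subr_gt0 invf_lt1.
    - by rewrite divr_gt0// subr_gt0 invf_lt1.
  apply H => //; last by rewrite lt_eqF.
  - by rewrite nmulr_rgt0 ?invr_lt0 subr_lt0 invf_gt1.
  - by rewrite nmulr_rgt0 ?invr_lt0 subr_lt0 invf_gt1.
set n := _ / _ => n0; set m := _ / _ => m0 r1.
have r1' : 1 - r^-1 != 0 by rewrite subr_eq0 eq_sym invr_eq1.
have pV : p^-1 = 1 + r^-1 - q^-1 by rewrite -pqr addrK.
have mn : m + n = 1.
  rewrite /m /n -mulrDl pV.
  have -> : 1 - (1 + r^-1 - q^-1) + (1 - q^-1) = 1 - r^-1 by ring.
  by rewrite mulfV.
have rp : r / p = 1 + (r - 1) * n.
  rewrite /n pV; have -> : r - 1 = r * (1 - r^-1) by field; rewrite gt_eqF.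
  rewrite mulrA mulrAC mulfK//; field; rewrite ?gt_eqF//.
have rq : r / q = 1 + (r - 1) * m.
  rewrite /m; have -> : r - 1 = r * (1 - r^-1) by field; rewrite gt_eqF.
  rewrite mulrA mulrAC mulfK//.
  have -> : q^-1 = 1 + r^-1 - p^-1 by rewrite -pqr addrC addKr.
  by field; rewrite ?gt_eqF.
have [phi0 a0 phiE [S [s [dS cs s0 oS FE]]]] := gauss_transport p0 (mulr_gt0 p0 n0) cf f0 fA.
have [psi0 b0 psiE [U [u [dU cu u0 oU GE]]]] := gauss_transport q0 (mulr_gt0 q0 m0) cg g0 gA.
set phi := fine _ in phi0 a0 phiE FE.
set psi := fine _ in psi0 b0 psiE GE.
have gt1 := core_gt1 p0 q0 r0 m0 n0 mn rp rq cf cg f0 g0 fA gA a0 b0 dS dU cs cu s0 u0 oS oU FE GE.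
have lt1 := core_lt1 p0 q0 r0 m0 n0 mn rp rq cf cg f0 g0 fA gA a0 b0 dS dU cs cu s0 u0 oS oU FE GE.
set B := (X in X * Num.sqrt pi) in gt1 lt1.
(* The masses contribute [phi^(1/p)] and [psi^(1/q)], which are the two norms; the remaining
   Gaussian constants are those of [young_const_identity]. *)
have BE : B * Num.sqrt pi = K * phi `^ p^-1 * psi `^ q^-1.
  rewrite /B /K -(@young_const_identity _ p q r m n)//.
  set k := Num.sqrt (pi / _); set c1 := Num.sqrt (p * n / pi).
  set c2 := Num.sqrt (q * m / pi).
  have c10 : 0 <= c1 by exact: sqrtr_ge0.
  have c20 : 0 <= c2 by exact: sqrtr_ge0.
  rewrite (powRM _ (mulr_ge0 (powR_ge0 _ _) (powR_ge0 _ _)) (sqrtr_ge0 _)).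
  rewrite (powRM _ (powR_ge0 _ _) (powR_ge0 _ _)) -!powRrM.
  have -> : r / p / r = p^-1 by field; rewrite !gt_eqF.
  have -> : r / q / r = q^-1 by field; rewrite !gt_eqF.
  rewrite (powRM _ (ltW phi0) c10) (powRM _ (ltW psi0) c20).
  have E (x1 x2 x3 x4 x5 x6 : R) :
    x1 * x2 * (x3 * x4) * x5 * x6 = x2 * x4 * (x5 * x6) * x1 * x3 by ring.
  exact: E.
have RHSE : RHS = (B * Num.sqrt pi)%:E.
  rewrite BE /RHS /pnorm /=.
  by rewrite phiE psiE !poweR_EFin -!EFinM.
have WrE : Wr = (fine (\int[lambda]_x (fine (lconv (EFin \o f) (EFin \o g) x) `^ r)%:E)%E `^ r^-1)%:E.
  rewrite -poweR_EFin /Wr /pnorm.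
  rewrite -(fine_integral_lconv_powR r0 cf cg f0 g0 fA gA); congr (_ `^ _)%E.
  by apply: eq_integral => x _; rewrite (fine_lconv cf cg f0 g0 fA gA).
by rewrite RHSE WrE !lee_fin.
Qed.

End gaussian_dominated.

(** * The general one-dimensional inequality *)

Section nd_sup.
Context (R : realType).
Local Open Scope ereal_scope.
Implicit Types (a b : nat -> \bar R) (x y : \bar R).

(** A monotone limit stated through upper bounds instead of convergence, so that it passes through
    products even at [0 * +oo], where multiplication is not continuous. *)
Definition nd_sup a x := [/\ forall k l, (k <= l)%N -> a k <= a l,
  forall k, 0 <= a k, forall k, a k <= x &
  forall C, (forall k, a k <= C) -> x <= C].

Lemma nd_sup_ge0 a x : nd_sup a x -> 0 <= x.
Proof. by move=> [_ a0 ax _]; exact: le_trans (a0 0%N) (ax 0%N). Qed.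

Lemma nd_sup_mulr a x y C : nd_sup a x -> 0 <= y ->
  (forall k, a k * y <= C) -> x * y <= C.
Proof.
move=> ax y0 ayC; have x0 := nd_sup_ge0 ax; case: ax => _ a0 ax axC.
have C0 : 0 <= C by apply: le_trans (ayC 0%N); exact: mule_ge0.
have [->|yN0] := eqVneq y 0; first by rewrite mule0.
have y_gt0 : 0 < y by rewrite lt0e yN0.
case: y y0 ayC yN0 y_gt0 => [y| |]// y0 ayC yN0 y_gt0.
  by rewrite -lee_pdivlMr//; apply: axC => k; rewrite lee_pdivlMr.
(* Here [y = +oo]: a positive term [a k] forces [C = +oo], and otherwise [x = 0], with
   [0 * +oo = 0]. *)
have [[k ak]|nk] := pselect (exists k, 0 < a k).
  by have := ayC k; rewrite gt0_muley// leye_eq => /eqP ->; rewrite leey.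
have : x <= 0.
  by apply: axC => k; rewrite leNgt; apply/negP => ak; apply: nk; exists k.
by move=> x0'; have -> : x = 0; [apply/eqP; rewrite eq_le x0'|rewrite mul0e].
Qed.

Lemma nd_sup_mul a b x y : nd_sup a x -> nd_sup b y ->
  nd_sup (fun k => a k * b k) (x * y).
Proof.
move=> ax by_; have x0 := nd_sup_ge0 ax; have y0 := nd_sup_ge0 by_.
have [nda a0 lea _] := ax; have [ndb b0 leb _] := by_.
split.
- by move=> k l kl; apply: lee_pmul => //; [exact: nda|exact: ndb].
- by move=> k; exact: mule_ge0.
- by move=> k; exact: lee_pmul.
(* The two suprema are taken one after the other, which produces two indices; monotonicity brings
   both to their maximum. *)
- move=> C abC; apply: (nd_sup_mulr ax y0) => k.
  rewrite muleC; apply: (nd_sup_mulr by_ (a0 k)) => l; rewrite muleC.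
  apply: le_trans (abC (maxn k l)); apply: lee_pmul => //.
    by apply: nda; exact: leq_maxl.
  by apply: ndb; exact: leq_maxr.
Qed.

Lemma nd_sup_cst x : 0 <= x -> nd_sup (fun=> x) x.
Proof. by move=> x0; split => // C; apply; exact: 0%N. Qed.

Lemma poweR_invK x (r : R) : (0 < r)%R -> 0 <= x -> (x `^ r) `^ r^-1 = x.
Proof. by move=> r0 x0; rewrite -poweRrM mulfV ?gt_eqF// poweRe1. Qed.

Lemma poweR_Kinv x (r : R) : (0 < r)%R -> 0 <= x -> (x `^ r^-1) `^ r = x.
Proof. by move=> r0 x0; rewrite -poweRrM mulVf ?gt_eqF// poweRe1. Qed.

Lemma nd_sup_poweR a x (r : R) : (0 < r)%R -> nd_sup a x ->
  nd_sup (fun k => a k `^ r) (x `^ r).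
Proof.
move=> r0 ax; have x0 := nd_sup_ge0 ax; have [nda a0 lea axC] := ax.
split.
- by move=> k l kl; apply: (le_poweR (ltW r0)) => //; exact: nda.
- by move=> k; exact: poweR_ge0.
- by move=> k; exact: (le_poweR (ltW r0)).
- move=> C arC; have C0 : 0 <= C by exact: le_trans (poweR_ge0 _ _) (arC 0%N).
  rewrite -(poweR_Kinv r0 C0); apply: (le_poweR (ltW r0)) => //.
  apply: axC => k; rewrite -(poweR_invK r0 (a0 k)).
  by apply: le_poweR; rewrite ?poweR_ge0// invr_ge0 ltW.
Qed.

Context d (T : measurableType d) (mu : {measure set T -> \bar R}).
Implicit Types (h : nat -> T -> \bar R) (f : T -> \bar R).

Lemma nd_sup_integral h f : (forall k, measurable_fun [set: T] (h k)) ->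
  measurable_fun [set: T] f ->
  (forall t, nd_sup (h ^~ t) (f t)) ->
  nd_sup (fun k => \int[mu]_t h k t) (\int[mu]_t f t).
Proof.
move=> mh mf hf.
have h0 k t : 0 <= h k t by case: (hf t).
have hle k l t : (k <= l)%N -> h k t <= h l t by case: (hf t) => + _ _ _; exact.
have hf' k t : h k t <= f t by case: (hf t).
split.
- by move=> k l kl; apply: ge0_le_integral => // t _; exact: hle.
- by move=> k; apply: integral_ge0.
- by move=> k; apply: ge0_le_integral.
- move=> C hC.
  have hlim t : f t = limn (h ^~ t).
    have cvgh : h ^~ t @ \oo --> ereal_sup (range (h ^~ t)).
      by apply: ereal_nondecreasing_cvgn => k l kl; exact: hle.
    rewrite (cvg_lim _ cvgh)//; apply/eqP; rewrite eq_le; apply/andP; split.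
      case: (hf t) => _ _ _; apply => k; apply: ereal_sup_ubound.
      by exists k.
    by apply: ge_ereal_sup => _ [k _ <-].
  rewrite (eq_integral (fun t => limn (h ^~ t))) => [|t _]; last exact: hlim.
  rewrite monotone_convergence//; last by move=> t _ k l kl; exact: hle.
  apply: lime_le; last exact: nearW.
  apply: ereal_nondecreasing_is_cvgn => k l kl.
  by apply: ge0_le_integral => // t _; exact: hle.
Qed.

Lemma nd_sup_pnorm h f (r : R) : (0 < r)%R ->
  (forall k, measurable_fun [set: T] (h k)) -> measurable_fun [set: T] f ->
  (forall t, nd_sup (h ^~ t) (f t)) ->
  nd_sup (fun k => pnorm mu r (h k)) (pnorm mu r f).
Proof.
move=> r0 mh mf hf; apply: nd_sup_poweR; first by rewrite invr_gt0.
apply: nd_sup_integral => [k||t].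
- exact: measurable_poweR_comp.
- exact: measurable_poweR_comp.
- exact: nd_sup_poweR.
Qed.

End nd_sup.

Lemma nd_sup_lconv (R : realType) (h l : nat -> R -> \bar R) (f g : R -> \bar R) x :
  (forall k, measurable_fun [set: R] (h k)) -> measurable_fun [set: R] f ->
  (forall k, measurable_fun [set: R] (l k)) -> measurable_fun [set: R] g ->
  (forall t, nd_sup (h ^~ t) (f t)) -> (forall t, nd_sup (l ^~ t) (g t)) ->
  nd_sup (fun k => lconv (h k) (l k) x) (lconv f g x).
Proof.
move=> mh mf ml mg hf lg.
have mB : measurable_fun [set: measurableTypeR R] (fun y : R => x - y).
  exact: measurable_funB.
apply: nd_sup_integral => [k||t].
- by apply: emeasurable_funM; [exact: (measurableT_comp (mh k))|exact: ml].
- by apply: emeasurable_funM => //; exact: (measurableT_comp mf).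
- exact: nd_sup_mul.
Qed.

Section truncation.
Context (R : realType).
Implicit Types (f : R -> \bar R).

(** One parameter is both height and radius, to match the single constant [M] of [young_bounded].
    The interval is open so that the truncation already vanishes where [|x| = k]. *)
Definition trunc_fun f (k : nat) (x : R) : R :=
  fine (mine (f x) k%:R%:E) * \1_(`](- k%:R), k%:R[%classic : set R) x.

Lemma measurable_trunc_fun f k : measurable_fun [set: R] f ->
  measurable_fun [set: R] (trunc_fun f k).
Proof.
move=> mf; apply: measurable_funM.
  by apply: measurableT_comp => //; exact: measurable_mine.
by apply: measurable_indic; exact: measurable_itv.
Qed.

Variable f : R -> \bar R.
Hypothesis f0 : forall x, (0 <= f x)%E.

Lemma mine_trunc_fin k x : mine (f x) k%:R%:E \is a fin_num.
Proof.
rewrite ge0_fin_numE; first by rewrite gt_min ltry orbT.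
by rewrite le_min f0 lee_fin/=.
Qed.

Lemma trunc_fun_ge0 k x : 0 <= trunc_fun f k x.
Proof.
by rewrite mulr_ge0// fine_ge0// le_min f0 lee_fin/=.
Qed.

Lemma trunc_fun_le k x : trunc_fun f k x <= k%:R.
Proof.
rewrite /trunc_fun indicE; case: (x \in _); rewrite ?mulr1 ?mulr0//.
by rewrite -lee_fin fineK ?mine_trunc_fin// ge_min lexx orbT.
Qed.

Lemma trunc_fun_support k x : k%:R <= `|x| -> trunc_fun f k x = 0.
Proof.
move=> kx; rewrite /trunc_fun indicE memNset ?mulr0//= in_itv/= => /andP[h1 h2].
by move: kx; rewrite leNgt ltr_norml h1 h2.
Qed.

Lemma nd_sup_trunc_fun x : nd_sup (fun k => (trunc_fun f k x)%:E) (f x).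
Proof.
have tE k : `|x| < k%:R -> (trunc_fun f k x)%:E = mine (f x) k%:R%:E.
  rewrite ltr_norml => xk; rewrite /trunc_fun indicE mem_set ?mulr1.
    by rewrite fineK ?mine_trunc_fin.
  by rewrite /= in_itv/= xk.
split.
- move=> k l kl; have [xk|kx] := ltP `|x| k%:R; last first.
    by rewrite trunc_fun_support// lee_fin trunc_fun_ge0.
  have kl' : k%:R <= l%:R :> R by rewrite ler_nat.
  rewrite !tE//; last exact: lt_le_trans kl'.
  by rewrite le_min ge_min lexx/= ge_min lee_fin kl' orbT.
- by move=> k; rewrite lee_fin trunc_fun_ge0.
- move=> k; have [xk|kx] := ltP `|x| k%:R; last by rewrite trunc_fun_support.
  by rewrite tE// ge_min lexx.
- move=> C tC; have C0 : (0 <= C)%E.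
    by apply: le_trans (tC 0%N); rewrite lee_fin trunc_fun_ge0.
  case: C tC C0 => [C| |]// tC C0; last by rewrite leey.
  pose k := (Num.trunc (Num.max `|x| C)).+1.
  have := truncnS_gt (Num.max `|x| C); rewrite -/k gt_max => /andP[xk Ck].
  have := tC k; rewrite tE// ge_min => /orP[//|].
  by rewrite lee_fin leNgt Ck.
Qed.

End truncation.

Section ae_imply.
Context d (T : measurableType d) (R : realType).
Variable mu : {measure set T -> \bar R}.
Implicit Types P Q : T -> Prop.

Lemma ae_imply P Q : (forall x, P x -> Q x) ->
  {ae mu, forall x, P x} -> {ae mu, forall x, Q x}.
Proof. by move=> PQ; apply: filterS. Qed.

Lemma ae_imply2 P Q S : (forall x, P x -> Q x -> S x) ->
  {ae mu, forall x, P x} -> {ae mu, forall x, Q x} -> {ae mu, forall x, S x}.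
Proof. by move=> PQ; apply: filterS2. Qed.

Lemma ae_all P : (forall x, P x) -> {ae mu, forall x, P x}.
Proof. exact: nearW. Qed.

End ae_imply.

Section powR_cvg.
Context (R : realType).

(** For [l > 0] the power is differentiable, hence continuous, at [l]. At [l = 0] the threshold
    [e^(1/s)] for [u n] gives [e] for its power. *)
Lemma cvg_powR_seq (u : nat -> R) (l s : R) : 0 < s -> (forall n, 0 <= u n) ->
  u n @[n --> \oo] --> l -> u n `^ s @[n --> \oo] --> l `^ s.
Proof.
move=> s0 u0 ul; have l0 : 0 <= l.
  have lE := cvg_lim (@Rhausdorff R) ul; rewrite -lE.
  by apply: limr_ge; [apply/cvg_ex; exists l|exact: nearW].
have [l_gt0|l_le0] := ltP 0 l.
  have dl : derivable ((@powR R) ^~ s) l 1.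
    by apply: derivable_powR; rewrite in_itv/= l_gt0.
  have cl : {for l, continuous ((@powR R) ^~ s)}.
    exact/differentiable_continuous/derivable1_diffP.
  exact: (cvg_comp _ _ ul cl).
have l_eq0 : l = 0 by apply/eqP; rewrite eq_le l_le0 l0.
rewrite l_eq0 powR0 ?gt_eqF//; rewrite l_eq0 in ul.
apply/cvgrPdist_lt => e e0.
have e1 : 0 < e `^ s^-1 by rewrite powR_gt0.
move/cvgrPdist_lt : ul => /(_ _ e1).
apply: filterS => n; rewrite !sub0r !normrN !ger0_norm ?powR_ge0// => un.
rewrite -(@powRr1 _ e) ?(ltW e0)// -(mulVf (lt0r_neq0 s0)) powRrM.
by apply: gt0_ltr_powR; rewrite ?nnegrE ?powR_ge0.
Qed.

Lemma cvg_poweR_seq (u : nat -> \bar R) (l : \bar R) (s : R) : 0 < s ->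
  (forall n, (0 <= u n)%E) -> (l \is a fin_num) ->
  (u n @[n --> \oo] --> l)%E -> (u n `^ s @[n --> \oo] --> l `^ s)%E.
Proof.
move=> s0 u0 lf; rewrite -(fineK lf) => /fine_cvgP[uf ul].
apply/fine_cvgP; split.
  by apply: filterS uf => n un; rewrite fin_num_poweR.
have -> : fine \o (fun n => u n `^ s)%E = (fun n => fine (u n) `^ s).
  by apply/funext => n /=; rewrite fine_poweR.
by apply: cvg_powR_seq => // n; exact: fine_ge0.
Qed.

End powR_cvg.

(** * Limits under a common Gaussian bound *)

Section dominated.
Context (R : realType).
Local Notation lambda := (@lebesgue_measure R).
Local Open Scope ereal_scope.

Lemma integrable_gauss_bound (D c : R) : (0 < c)%R ->
  lambda.-integrable [set: R] (fun x => (D * expR (- (c * x ^+ 2)))%:E).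
Proof.
move=> c0; have := integrableZl measurableT D (integrable_gauss_scale 0 c0).
by apply: eq_integrable => // x _; rewrite /= subr0.
Qed.

(** Dominated convergence for the powers, whose bound is again Gaussian, then continuity of the
    root. Finiteness of the limit is recorded because products of norms are taken to the limit
    later. *)
Lemma pnorm_dominated_cvg (u_ : nat -> R -> \bar R) (u : R -> \bar R)
    (D c s : R) : (0 < c)%R -> (0 < s)%R ->
  (forall n, measurable_fun [set: R] (u_ n)) -> measurable_fun [set: R] u ->
  (forall n x, 0 <= u_ n x) -> (forall x, 0 <= u x) ->
  (forall n x, u_ n x <= (D * expR (- (c * x ^+ 2)))%:E) ->
  (forall x, u x <= (D * expR (- (c * x ^+ 2)))%:E) ->
  {ae lambda, forall x, u_ n x @[n --> \oo] --> u x} ->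
  pnorm lambda s u \is a fin_num /\
  pnorm lambda s (u_ n) @[n --> \oo] --> pnorm lambda s u.
Proof.
move=> c0 s0 mu_ mu u_0 u0 u_D uD cvgu.
have D0 : (0 <= D)%R.
  have := le_trans (u0 0%R) (uD 0%R).
  by rewrite lee_fin pmulr_lge0 ?expR_gt0.
have bound (v : R -> \bar R) x : 0 <= v x -> v x <= (D * expR (- (c * x ^+ 2)))%:E ->
    v x `^ s <= (D `^ s * expR (- (s * c * x ^+ 2)))%:E.
  move=> v0 /(le_poweR (ltW s0) v0) H; apply: (le_trans H).
  rewrite poweR_EFin lee_fin powRM ?expR_ge0// powR_expR.
  by rewrite mulrN mulrA.
have cvgs : {ae lambda, forall x, [set: R] x ->
    u_ n x `^ s @[n --> \oo] --> u x `^ s}.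
  apply: ae_imply cvgu => x cvgx _; apply: cvg_poweR_seq => //.
  by rewrite ge0_fin_numE//; exact: le_lt_trans (uD x) (ltry _).
have bounds : {ae lambda, forall x n, [set: R] x ->
    `|u_ n x `^ s| <= (D `^ s * expR (- (s * c * x ^+ 2)))%:E}.
  by apply: ae_all => x n _; rewrite gee0_abs ?poweR_ge0//; exact: bound.
have [iu _ cvgI] := @dominated_convergence _ _ R lambda setT measurableT
  (fun n x => u_ n x `^ s) (fun x => u x `^ s) _
  (fun n => measurable_poweR_comp s (mu_ n)) (measurable_poweR_comp s mu)
  cvgs (integrable_gauss_bound (D `^ s)%R (mulr_gt0 s0 c0)) bounds.
have Ifin := integrable_fin_num measurableT iu.
split; first exact: fin_num_poweR.
apply: cvg_poweR_seq => //; first by rewrite invr_gt0.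
by move=> n; apply: integral_ge0 => x _; exact: poweR_ge0.
Qed.

Lemma ae_reflect (x : R) (P : R -> Prop) : {ae lambda, forall y, P y} ->
  {ae lambda, forall y, P (x - y)%R}.
Proof.
move=> [N [mN N0 PN]].
have mB : measurable_fun [set: measurableTypeR R] (fun y : R => (x - y)%R).
  exact: measurable_funB.
exists ((fun y : R => (x - y)%R) @^-1` N); split.
- by rewrite -[X in measurable X]setTI; exact: mB.
- have mI : measurable_fun [set: R] (EFin \o (\1_N : R -> R)).
    by apply/measurable_EFinP; exact: measurable_indic.
  have I0 y : 0 <= (EFin \o (\1_N : R -> R)) y by rewrite /= lee_fin indicE.
  have IN : \int[lambda]_y (EFin \o (\1_N : R -> R)) y = 0.
    by transitivity (lambda N) => //; rewrite integral_indic// setIT.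
  have mp : measurable ((fun y : R => (x - y)%R) @^-1` N : set (measurableTypeR R)).
    by rewrite -[X in measurable X]setTI; exact: mB.
  transitivity (\int[lambda]_y (EFin \o (\1_N : R -> R)) (x - y)%R).
    by rewrite -[in LHS](setIT (_ @^-1` _)) -integral_indic.
  by rewrite ge0_integral_reflect.
- by move=> y /= nP; apply: PN.
Qed.

Variables (f_ g_ : nat -> R -> R) (f g : R -> R) (A : R).
Hypotheses (mf_ : forall n, measurable_fun [set: R] (f_ n))
  (mg_ : forall n, measurable_fun [set: R] (g_ n)).
Hypotheses (mf : measurable_fun [set: R] f) (mg : measurable_fun [set: R] g).
Hypotheses (f_0 : forall n x, (0 <= f_ n x)%R) (g_0 : forall n x, (0 <= g_ n x)%R).
Hypotheses (f0 : forall x, (0 <= f x)%R) (g0 : forall x, (0 <= g x)%R).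
Hypotheses (f_A : forall n x, (f_ n x <= A * expR (- x ^+ 2))%R).
Hypotheses (g_A : forall n x, (g_ n x <= A * expR (- x ^+ 2))%R).
Hypotheses (fA : forall x, (f x <= A * expR (- x ^+ 2))%R).
Hypotheses (gA : forall x, (g x <= A * expR (- x ^+ 2))%R).
Hypothesis cvgf : {ae lambda, forall x, f_ n x @[n --> \oo] --> f x}.
Hypothesis cvgg : {ae lambda, forall x, g_ n x @[n --> \oo] --> g x}.

Lemma lconv_dominated_cvg x :
  lconv (EFin \o f_ n) (EFin \o g_ n) x @[n --> \oo] --> lconv (EFin \o f) (EFin \o g) x.
Proof.
have A0 : (0 <= A)%R by have := le_trans (f0 0%R) (fA 0%R); rewrite pmulr_lge0 ?expR_gt0.
have mB : measurable_fun [set: measurableTypeR R] (fun y : R => (x - y)%R).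
  exact: measurable_funB.
have [] := @dominated_convergence _ _ R lambda _ measurableT
  (fun n y => (f_ n (x - y) * g_ n y)%:E) (fun y => (f (x - y) * g y)%:E)
  (fun y => (A ^+ 2 * expR (- (1 * y ^+ 2)))%:E).
- move=> n; apply/measurable_EFinP; apply: measurable_funM; last exact: mg_.
  exact: (measurableT_comp (mf_ n)).
- apply/measurable_EFinP; apply: measurable_funM; last exact: mg.
  exact: (measurableT_comp mf).
- apply: ae_imply2 (ae_reflect x cvgf) cvgg => y cf cg _.
  apply: cvg_EFin; first exact: nearW.
  exact: cvgM.
- exact: integrable_gauss_bound.
- apply: ae_all => y n _; rewrite gee0_abs ?lee_fin ?mulr_ge0//.
  (* Only the Gaussian in [y] is kept; the one in [x - y] is bounded by [1]. *)
  rewrite mul1r expr2 -mulrA; apply: ler_pM => //.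
  by apply: (le_trans (f_A n _)); rewrite ler_piMr// expR_le1 oppr_le0 sqr_ge0.
- by move=> _ _; apply.
Qed.

End dominated.

Section regularization.
Context (R : realType).
Local Notation lambda := (@lebesgue_measure R).
Variables (f : R -> R) (M : R).
Hypothesis mf : measurable_fun [set: R] f.
Hypothesis f0 : forall x, 0 <= f x.
Hypothesis fM : forall x, f x <= M.
Hypothesis f_supp : forall x, M <= `|x| -> f x = 0.

(* The first term dominates the Steklov means of [f], supported in
   [[- M - 1, M]]; the second one is for the Gaussian added by [regularize]. *)
Let A := M * expR ((M + 1) ^+ 2) + 1.

Local Lemma M_ge0 : 0 <= M.
Proof. exact: le_trans (f0 0) (fM 0). Qed.

Local Lemma gauss_ge (a x : R) : 0 <= a -> `|x| <= M + 1 -> a <= M ->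
  a <= M * expR ((M + 1) ^+ 2) * expR (- x ^+ 2).
Proof.
move=> a0 xM aM; rewrite -mulrA -expRD; apply: (le_trans aM).
rewrite ler_peMr ?M_ge0// -[leLHS]expR0 ler_expR subr_ge0 -real_normK ?num_real//.
by rewrite lerXn2r ?nnegrE ?addr_ge0 ?M_ge0.
Qed.

Lemma compact_support_gauss_le x : f x <= A * expR (- x ^+ 2).
Proof.
have := M_ge0 => M0; have [xM|Mx] := leP M `|x|.
  rewrite f_supp//; apply: mulr_ge0; last exact: expR_ge0.
  by rewrite addr_ge0// mulr_ge0// expR_ge0.
rewrite /A mulrDl mul1r; apply: (@le_trans _ _ (M * expR ((M + 1) ^+ 2) * expR (- x ^+ 2))).
  apply: gauss_ge => //; rewrite ltW// (lt_trans Mx)// ltrDl//.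
by rewrite lerDl expR_ge0.
Qed.

Local Lemma int_f : lambda.-integrable [set: R] (EFin \o f).
Proof.
apply: (@le_integrable _ _ _ lambda _ measurableT _ (fun x => (A * expR (- (1 * x ^+ 2)))%:E)).
- exact/measurable_EFinP.
- move=> x _; rewrite !gee0_abs ?lee_fin//; first by rewrite mul1r compact_support_gauss_le.
  by rewrite mul1r; apply: le_trans (compact_support_gauss_le x).
- exact: integrable_gauss_bound.
Qed.

Let Phi x := \int[lambda]_(t in `]-oo, x]) f t.

Local Lemma PhiB x y : x <= y -> 0 <= Phi y - Phi x <= M * (y - x).
Proof.
move=> xy; rewrite /Phi Rintegral_itvB//; last exact: integrableS int_f.
apply/andP; split; first by apply: Rintegral_ge0.
rewrite -lee_fin /Rintegral fineK; last first.
  by apply: integrable_fin_num => //; exact: integrableS int_f.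
apply: (@le_trans _ _ (\int[lambda]_(t in `]x, y]) (cst M%:E) t)%E).
  apply: ge0_le_integral => //.
  - by move=> t _; rewrite lee_fin.
  - by apply: measurable_funTS; exact/measurable_EFinP.
  - by move=> t _; rewrite lee_fin.
have muI : lambda (`]x, y]%classic : set (measurableTypeR R)) = (y - x)%:E.
  rewrite lebesgue_measure_itv/= lte_fin; case: ltP => [_|yx]; first by rewrite EFinB.
  by have -> : x = y; [apply/eqP; rewrite eq_le xy yx|rewrite subrr].
have -> : (\int[lambda]_(t in `]x, y]) (cst M%:E) t = M%:E * (y - x)%:E)%E.
  by rewrite -muI; exact: integral_cst.
by rewrite -EFinM.
Qed.

Local Lemma Phi_const x y : x <= y -> (forall t, x < t <= y -> f t = 0) ->
  Phi y - Phi x = 0.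
Proof.
move=> xy ft0; rewrite /Phi Rintegral_itvB//; last exact: integrableS int_f.
rewrite (@eq_Rintegral _ _ _ lambda _ (cst 0)).
  by rewrite /Rintegral integral0.
by move=> t; rewrite inE/= in_itv/= => /ft0.
Qed.

Local Lemma Phi_continuous : continuous Phi.
Proof.
have M0 := M_ge0.
have lip x y : `|Phi x - Phi y| <= M * `|x - y|.
  wlog xy : x y / y <= x.
    by move=> H; case: (leP y x) => [/H//|/ltW/H]; rewrite distrC [`|y - x|]distrC.
  have /andP[h1 h2] := PhiB xy.
  by rewrite !ger0_norm ?subr_ge0// -subr_ge0.
move=> x; apply/cvgrPdist_lt => e e0.
have d0 : 0 < e / (M + 1) by rewrite divr_gt0// ltr_wpDl.
near=> y.
apply: (le_lt_trans (lip _ _)).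
apply: (@le_lt_trans _ _ ((M + 1) * `|x - y|)).
  by rewrite ler_wpM2r// lerDl.
have M1 : 0 < M + 1 by rewrite ltr_wpDl.
by rewrite mulrC -ltr_pdivlMr.
Unshelve. all: end_near. Qed.

(* A Steklov mean, continuous since [f] is bounded, plus a small Gaussian, which
   makes it positive. *)
Definition regularize (n : nat) x :=
  n.+1%:R * (Phi (x + n.+1%:R^-1) - Phi x) + n.+1%:R^-1 * expR (- x ^+ 2).

Lemma continuous_regularize n : continuous (regularize n).
Proof.
have c1 : continuous (fun x : R => Phi (x + n.+1%:R^-1)).
  move=> x; apply: (@continuous_comp _ _ _ (fun x : R => x + n.+1%:R^-1) Phi).
    by apply: cvgD; [exact: cvg_id|exact: cvg_cst].
  exact: Phi_continuous.
have c2 : continuous (expR \o (fun x : R => - x ^+ 2)).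
  move=> x; apply: continuous_comp; last exact: continuous_expR.
  by apply: cvgN; exact: exprn_continuous.
move=> x; apply: cvgD; apply: cvgM; try exact: cvg_cst.
- by apply: cvgB; [exact: c1|exact: Phi_continuous].
- exact: c2.
Qed.

Local Lemma le_shift n x : x <= x + n.+1%:R^-1 :> R.
Proof. by rewrite lerDl. Qed.

Lemma regularize_gt0 n x : 0 < regularize n x.
Proof.
apply: ltr_wpDl; last by rewrite mulr_gt0 ?expR_gt0.
by rewrite mulr_ge0//; have /andP[] := PhiB (le_shift n x).
Qed.

(** For [|x| <= M + 1] the Steklov mean is at most [M]. Beyond, its window starts at [x] and has
    length at most [1], so it misses the support of [f] and the mean is [0]. The added Gaussian is
    paid by the summand [1] of [A]. *)
Lemma regularize_le n x : regularize n x <= A * expR (- x ^+ 2).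
Proof.
have M0 := M_ge0; have h0 : 0 < n.+1%:R^-1 :> R by [].
have h1 : n.+1%:R^-1 <= 1 :> R by rewrite invf_le1// ler1n.
rewrite /A mulrDl mul1r lerD//; last by rewrite ler_piMl ?expR_ge0.
have [xM|Mx] := leP `|x| (M + 1).
  apply: gauss_ge => //.
    by rewrite mulr_ge0//; have /andP[] := PhiB (le_shift n x).
  have /andP[_] := PhiB (le_shift n x).
  by rewrite [x + _ - x]addrAC subrr add0r -ler_pdivrMr// invrK mulrC.
rewrite Phi_const ?le_shift ?mulr0 ?mulr_ge0 ?expR_ge0//.
move=> t /andP[xt tx]; apply: f_supp.
move: tx h1 h0 Mx; move: (n.+1%:R^-1) => h tx h1 h0.
by rewrite ltr_normr ler_normr => /orP[Mx|Mx]; apply/orP; [left|right]; lra.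
Qed.

(** Lebesgue differentiation: at almost every [x] the difference quotients of [Phi] tend to [f x],
    here along the steps [1/(n+1)]. *)
Lemma ae_cvg_regularize :
  {ae lambda, forall x, regularize n x @[n --> \oo] --> f x}.
Proof.
have lf : locally_integrable [set: R] f.
  by apply: open_integrable_locally; [exact: openT|exact: int_f].
have intNy y : lambda.-integrable `]-oo, y] (EFin \o f).
  exact: integrableS int_f.
have := FTC1Ny intNy lf.
apply: ae_imply => x [dPhi PhiE].
have : (fun h : R => h^-1 * (Phi (h + x) - Phi x)) @ 0^' --> f x.
  rewrite -PhiE; have := dPhi; rewrite /derivable.
  rewrite derive1E /derive.
  under eq_fun do rewrite /GRing.scale/= mulr1.
  by [].
move=> /cvgrPdist_lt cvgh.
have c1 : n.+1%:R * (Phi (x + n.+1%:R^-1) - Phi x) @[n --> \oo] --> f x.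
  apply/cvgrPdist_lt => e e0; have := cvgh e e0.
  move=> [d /= d0 dH]; move/cvgrPdist_lt : (@cvg_harmonic R) => /(_ d d0).
  apply: filterS => n hn; have := dH _ hn.
  rewrite /= /harmonic invr_eq0 pnatr_eq0/= => /(_ isT).
  by rewrite invrK [_^-1 + x]addrC.
have c2 : n.+1%:R^-1 * expR (- x ^+ 2) @[n --> \oo] --> (0 : R).
  rewrite -[X in _ --> X](mul0r (expR (- x ^+ 2))).
  by apply: cvgM; [exact: cvg_harmonic|exact: cvg_cst].
by rewrite -[X in _ --> X]addr0; exact: cvgD c1 c2.
Qed.

End regularization.

(** * Exponents equal to one, and passage to all Borel functions *)

Section young1.
Context (R : realType).
Local Notation lambda := (@lebesgue_measure R).
Local Open Scope ereal_scope.

Lemma pnormZ d (T : measurableType d) (mu : {measure set T -> \bar R}) (r : R)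
    (c : \bar R) (f : T -> \bar R) : (0 < r)%R -> 0 <= c ->
  measurable_fun [set: T] f -> (forall x, 0 <= f x) ->
  pnorm mu r (fun x => c * f x) = c * pnorm mu r f.
Proof.
move=> r0 c0 mf f0; rewrite /pnorm.
under eq_integral do rewrite poweRM//.
rewrite ge0_integralZl//.
- rewrite poweRM ?poweR_ge0//; last by apply: integral_ge0 => x _; exact: poweR_ge0.
  by rewrite poweR_invK.
- exact: measurable_poweR_comp.
- by move=> x _; exact: poweR_ge0.
- exact: poweR_ge0.
Qed.

Lemma lconvC (f g : R -> \bar R) :
  measurable_fun [set: R] f -> measurable_fun [set: R] g ->
  (forall y, 0 <= f y) -> (forall y, 0 <= g y) -> lconv f g = lconv g f.
Proof.
move=> mf mg f0 g0; apply/funext => x; rewrite /lconv.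
have mB : measurable_fun [set: measurableTypeR R] (fun y : R => (x - y)%R).
  exact: measurable_funB.
rewrite -(@ge0_integral_reflect R (fun y => f (x - y)%R * g y) x)//.
- by apply: eq_integral => y _; rewrite subKr muleC.
- by apply: emeasurable_funM => //; exact: (measurableT_comp mf).
- by move=> y; exact: mule_ge0.
Qed.

Section young_L1.
Variables (f g : R -> \bar R) (r : R).
Hypotheses (mf : measurable_fun [set: R] f) (mg : measurable_fun [set: R] g).
Hypotheses (f0 : forall y, 0 <= f y) (g0 : forall y, 0 <= g y).

Let h (z : measurableTypeR R * measurableTypeR R) := f (z.1 - z.2)%R * g z.2.

Local Lemma mh : measurable_fun setT h.
Proof. exact: measurable_lconv_integrand. Qed.

Local Lemma h_ge0 z : 0 <= h z.
Proof. exact: mule_ge0. Qed.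

(** By translation invariance the section of [h] at [y] has norm [g y] times that of [f]. This
    computes one side of Minkowski's inequality for the kernel [h]. *)
Local Lemma integral_pnorm_section : (0 < r)%R ->
  \int[lambda]_y pnorm lambda r (fun x => h (x, y)) =
  pnorm lambda r f * pnorm lambda 1 g.
Proof.
move=> r0; rewrite pnorm1//.
transitivity (\int[lambda]_y (pnorm lambda r f * g y)); last first.
  by rewrite ge0_integralZl// pnorm_ge0.
apply: eq_integral => y _; rewrite muleC -[in RHS]pnormZ//.
have mfr : measurable_fun [set: R] (fun x => (g y * f x) `^ r).
  by apply: measurable_poweR_comp; exact: emeasurable_funM.
rewrite /pnorm; congr (_ `^ _).
rewrite -(@ge0_integral_shift R _ mfr _ (- y)%R)//.
  by apply: eq_integral => x _; rewrite /h/= muleC.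
by move=> x; exact: poweR_ge0.
Qed.

Lemma young_L1_ge1 : (1 <= r)%R ->
  pnorm lambda r (lconv f g) <= pnorm lambda r f * pnorm lambda 1 g.
Proof.
move=> r1; rewrite -integral_pnorm_section ?(lt_le_trans ltr01)//.
exact: (minkowski_integral lambda lambda mh h_ge0 r1).
Qed.

Lemma young_L1_le1 : (0 < r <= 1)%R ->
  pnorm lambda r f * pnorm lambda 1 g <= pnorm lambda r (lconv f g).
Proof.
move=> r1; rewrite -integral_pnorm_section; last by case/andP: r1.
exact: (minkowski_integral_reverse lambda lambda mh h_ge0 r1).
Qed.

End young_L1.

Variables (p q r : R).
Hypotheses (p0 : (0 < p)%R) (q0 : (0 < q)%R) (r0 : (0 < r)%R).
Hypothesis pqr : (p^-1 + q^-1 = 1 + r^-1)%R.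
Let K := (young_const p * young_const q / young_const r)%R.

Local Lemma K_ge0 : (0 <= K)%R.
Proof. by rewrite divr_ge0 ?mulr_ge0 ?ltW ?young_const_gt0. Qed.

Section bounded.
Variables (f g : R -> R) (M : R).
Hypotheses (mf : measurable_fun [set: R] f) (mg : measurable_fun [set: R] g).
Hypotheses (f0 : forall x, (0 <= f x)%R) (g0 : forall x, (0 <= g x)%R).
Hypotheses (fM : forall x, (f x <= M)%R) (gM : forall x, (g x <= M)%R).
Hypotheses (f_supp : forall x, (M <= `|x|)%R -> f x = 0%R)
  (g_supp : forall x, (M <= `|x|)%R -> g x = 0%R).

(** The regularizations are positive, continuous and below one Gaussian uniformly in [n], so they
    obey the inequality; dominated convergence carries all three norms to the limit. *)
Lemma young_bounded :
  ((1 < p)%R -> (1 < q)%R -> (1 < r)%R ->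
    pnorm lambda r (lconv (EFin \o f) (EFin \o g)) <=
    K%:E * pnorm lambda p (EFin \o f) * pnorm lambda q (EFin \o g)) /\
  ((p < 1)%R -> (q < 1)%R -> (r < 1)%R ->
    K%:E * pnorm lambda p (EFin \o f) * pnorm lambda q (EFin \o g) <=
    pnorm lambda r (lconv (EFin \o f) (EFin \o g))).
Proof.
pose f_ n := regularize f n; pose g_ n := regularize g n.
have cf n : continuous (f_ n) by exact: (continuous_regularize mf f0 fM f_supp).
have cg n : continuous (g_ n) by exact: (continuous_regularize mg g0 gM g_supp).
have f_0 n x : (0 < f_ n x)%R by exact: (regularize_gt0 mf f0 fM f_supp).
have g_0 n x : (0 < g_ n x)%R by exact: (regularize_gt0 mg g0 gM g_supp).
set A := (M * expR ((M + 1) ^+ 2) + 1)%R.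
have f_A n x : (f_ n x <= A * expR (- x ^+ 2))%R.
  exact: (regularize_le mf f0 fM f_supp).
have g_A n x : (g_ n x <= A * expR (- x ^+ 2))%R.
  exact: (regularize_le mg g0 gM g_supp).
have fA x : (f x <= A * expR (- x ^+ 2))%R by exact: compact_support_gauss_le.
have gA x : (g x <= A * expR (- x ^+ 2))%R by exact: compact_support_gauss_le.
have cvgf := ae_cvg_regularize mf f0 fM f_supp.
have cvgg := ae_cvg_regularize mg g0 gM g_supp.
have mf_ n : measurable_fun [set: R] (f_ n) by exact: continuous_measurable_fun.
have mg_ n : measurable_fun [set: R] (g_ n) by exact: continuous_measurable_fun.
have young n := young_gaussian_dominated p0 q0 r0 pqr (@cf n) (@cg n) (f_0 n) (g_0 n)
  (f_A n) (g_A n).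
have cvg_real (h_ : nat -> R -> R) (h : R -> R) (s : R) : (0 < s)%R ->
    (forall n, measurable_fun [set: R] (h_ n)) -> measurable_fun [set: R] h ->
    (forall n x, (0 < h_ n x)%R) -> (forall x, (0 <= h x)%R) ->
    (forall n x, (h_ n x <= A * expR (- x ^+ 2))%R) ->
    (forall x, (h x <= A * expR (- x ^+ 2))%R) ->
    {ae lambda, forall x, h_ n x @[n --> \oo] --> h x} ->
    pnorm lambda s (EFin \o h) \is a fin_num /\
    pnorm lambda s (EFin \o h_ n) @[n --> \oo] --> pnorm lambda s (EFin \o h).
  move=> s0 mh_ mh h_0 h0 h_A hA cvgh.
  apply: (@pnorm_dominated_cvg R (fun n => EFin \o h_ n) (EFin \o h) A 1 s) => //.
  - by move=> n; apply/measurable_EFinP; exact: mh_.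
  - by apply/measurable_EFinP; exact: mh.
  - by move=> n x; rewrite /= lee_fin ltW.
  - by move=> n x; rewrite /= lee_fin mul1r.
  - by move=> x; rewrite /= lee_fin mul1r.
  - by apply: ae_imply cvgh => x cx; apply: cvg_EFin => //; exact: nearW.
have [Nf cvgNf] := cvg_real f_ f p p0 mf_ mf f_0 f0 f_A fA cvgf.
have [Ng cvgNg] := cvg_real g_ g q q0 mg_ mg g_0 g0 g_A gA cvgg.
have cvgR : K%:E * pnorm lambda p (EFin \o f_ n) * pnorm lambda q (EFin \o g_ n)
    @[n --> \oo] -->
    K%:E * pnorm lambda p (EFin \o f) * pnorm lambda q (EFin \o g).
  apply: cvgeM => //; first by rewrite mule_def_fin// fin_numM.
  by apply: cvgeZl.
have c2 : (0 < 2^-1 :> R)%R by rewrite invr_gt0.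
have mf' : measurable_fun [set: R] (EFin \o f) by apply/measurable_EFinP; exact: mf.
have mg' : measurable_fun [set: R] (EFin \o g) by apply/measurable_EFinP; exact: mg.
have mf_' n : measurable_fun [set: R] (EFin \o f_ n).
  by apply/measurable_EFinP; exact: mf_.
have mg_' n : measurable_fun [set: R] (EFin \o g_ n).
  by apply/measurable_EFinP; exact: mg_.
have [_ cvgW] : pnorm lambda r (lconv (EFin \o f) (EFin \o g)) \is a fin_num /\
    pnorm lambda r (lconv (EFin \o f_ n) (EFin \o g_ n)) @[n --> \oo] -->
    pnorm lambda r (lconv (EFin \o f) (EFin \o g)).
  apply: (@pnorm_dominated_cvg R (fun n => lconv (EFin \o f_ n) (EFin \o g_ n)) _
    (A ^+ 2 * Num.sqrt (pi / 2)) 2^-1 r c2 r0).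
  - by move=> n; apply: measurable_lconv => // y; rewrite lee_fin ltW.
  - by apply: measurable_lconv => // y; rewrite lee_fin.
  - by move=> n x; apply: lconv_ge0 => y; rewrite lee_fin ltW.
  - by move=> x; apply: lconv_ge0 => y; rewrite lee_fin.
  - by move=> n x; apply: lconv_gauss_le => // y; rewrite ltW.
  - by move=> x; exact: lconv_gauss_le.
  - apply: ae_all => x; apply: (lconv_dominated_cvg (A := A)) => //.
    + by move=> n y; rewrite ltW.
    + by move=> n y; rewrite ltW.
split=> p1 q1 r1.
  apply: (lee_cvg_to cvgW cvgR); apply: nearW => n.
  by have [+ _] := young n; exact.
apply: (lee_cvg_to cvgR cvgW); apply: nearW => n.
by have [_] := young n; exact.
Qed.

End bounded.

Variables (f g : R -> \bar R).
Hypotheses (mf : measurable_fun [set: R] f) (mg : measurable_fun [set: R] g).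
Hypotheses (f0 : forall y, 0 <= f y) (g0 : forall y, 0 <= g y).

(** Both sides are suprema along the truncations, infinite values included, so the inequality passes
    to them in either direction. *)
Local Lemma young1_neq1 :
  ((1 < p)%R -> (1 < q)%R -> (1 < r)%R -> pnorm lambda r (lconv f g) <=
    K%:E * pnorm lambda p f * pnorm lambda q g) /\
  ((p < 1)%R -> (q < 1)%R -> (r < 1)%R ->
    K%:E * pnorm lambda p f * pnorm lambda q g <= pnorm lambda r (lconv f g)).
Proof.
pose f_ k : R -> \bar R := EFin \o trunc_fun f k.
pose g_ k : R -> \bar R := EFin \o trunc_fun g k.
have mf_ k : measurable_fun [set: R] (f_ k).
  by apply/measurable_EFinP; exact: measurable_trunc_fun.
have mg_ k : measurable_fun [set: R] (g_ k).
  by apply/measurable_EFinP; exact: measurable_trunc_fun.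
have supf t : nd_sup (f_ ^~ t) (f t) by exact: nd_sup_trunc_fun.
have supg t : nd_sup (g_ ^~ t) (g t) by exact: nd_sup_trunc_fun.
have f_0 k y : 0 <= f_ k y by rewrite lee_fin trunc_fun_ge0.
have g_0 k y : 0 <= g_ k y by rewrite lee_fin trunc_fun_ge0.
have supW : nd_sup (fun k => pnorm lambda r (lconv (f_ k) (g_ k)))
    (pnorm lambda r (lconv f g)).
  apply: nd_sup_pnorm => // [k||x].
  - exact: measurable_lconv.
  - exact: measurable_lconv.
  - exact: nd_sup_lconv.
have K0 : 0 <= K%:E by rewrite lee_fin K_ge0.
have supR : nd_sup (fun k => K%:E * pnorm lambda p (f_ k) * pnorm lambda q (g_ k))
    (K%:E * pnorm lambda p f * pnorm lambda q g).
  apply: nd_sup_mul; last exact: nd_sup_pnorm.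
  by apply: nd_sup_mul; [exact: nd_sup_cst|exact: nd_sup_pnorm].
have young k := @young_bounded (trunc_fun f k) (trunc_fun g k) k%:R
  (measurable_trunc_fun k mf) (measurable_trunc_fun k mg)
  (trunc_fun_ge0 f0 k) (trunc_fun_ge0 g0 k) (trunc_fun_le f0 k) (trunc_fun_le g0 k)
  (@trunc_fun_support _ f k) (@trunc_fun_support _ g k).
have [_ _ leW supWC] := supW; have [_ _ leR supRC] := supR.
split=> p1 q1 r1.
  apply: supWC => k; apply: le_trans (leR k).
  by have [+ _] := young k; exact.
apply: supRC => k; apply: le_trans (leW k).
by have [_] := young k; exact.
Qed.

(** If [p = 1] then [q = r], and if [q = 1] then [p = r]; in both cases [K = 1] and Minkowski's
    inequality suffices. *)
Lemma young1 :
  ((1 <= p)%R -> (1 <= q)%R -> (1 <= r)%R -> pnorm lambda r (lconv f g) <=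
    K%:E * pnorm lambda p f * pnorm lambda q g) /\
  ((p <= 1)%R -> (q <= 1)%R -> (r <= 1)%R ->
    K%:E * pnorm lambda p f * pnorm lambda q g <= pnorm lambda r (lconv f g)).
Proof.
have yN t : (0 < t)%R -> young_const t != 0%R by move=> t0; rewrite gt_eqF ?young_const_gt0.
have [p1|pN1] := eqVneq p 1%R.
  have qr : q = r by apply: invr_inj; apply: (addrI 1%R); rewrite -pqr p1 invr1.
  have -> : K = 1%R by rewrite /K p1 young_const1 mul1r qr mulfV ?yN.
  rewrite mul1e p1 qr lconvC// [_ * _]muleC; split => _ _ r1.
    exact: young_L1_ge1.
  by apply: young_L1_le1 => //; rewrite r0.
have [q1|qN1] := eqVneq q 1%R.
  have pr : p = r by apply: invr_inj; apply: (addIr 1%R); rewrite [RHS]addrC -pqr q1 invr1.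
  have -> : K = 1%R by rewrite /K q1 young_const1 mulr1 pr mulfV ?yN.
  rewrite mul1e q1 pr; split => _ _ r1.
    exact: young_L1_ge1.
  by apply: young_L1_le1 => //; rewrite r0.
have [gt1 lt1] := young1_neq1.
split=> p1 q1 r1.
  have {}p1 : (1 < p)%R by rewrite lt_neqAle eq_sym pN1.
  have {}q1 : (1 < q)%R by rewrite lt_neqAle eq_sym qN1.
  (* [r = 1] would give [1/p + 1/q = 2], impossible when both exponents exceed [1]. *)
  apply: gt1 => //; rewrite lt_neqAle r1 andbT eq_sym; apply/eqP => rE.
  have : (p^-1 + q^-1 < 1 + 1)%R by rewrite ltrD// invf_lt1.
  by rewrite pqr rE invr1 ltxx.
have {}p1 : (p < 1)%R by rewrite lt_neqAle pN1.
have {}q1 : (q < 1)%R by rewrite lt_neqAle qN1.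
apply: lt1 => //; rewrite lt_neqAle r1 andbT; apply/eqP => rE.
have : (1 + 1 < p^-1 + q^-1)%R by rewrite ltrD// invf_gt1.
by rewrite pqr rE invr1 ltxx.
Qed.

End young1.

(** * Tensorization *)

Section tuples.
Context (R : realType).
Local Notation T := (measurableTypeR R).
Local Notation lambda := (@lebesgue_measure R).
Local Open Scope ereal_scope.

(** Convertible with [vsub], but typed on the product sigma-algebra, where coordinates can be split
    off. *)
Definition tsub n (x y : n.-tuple T) : n.-tuple T :=
  [tuple (tnth x i - tnth y i)%R | i < n].

Lemma measurable_tsub n :
  measurable_fun [set: n.-tuple T * n.-tuple T] (fun z => tsub z.1 z.2).
Proof.
apply/measurable_fun_tnthP => i.
rewrite (_ : _ \o _ = fun z : n.-tuple T * n.-tuple T => (tnth z.1 i - tnth z.2 i)%R).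
  apply: measurable_funB.
    exact: (measurableT_comp (@measurable_tnth _ T n i) measurable_fst).
  exact: (measurableT_comp (@measurable_tnth _ T n i) measurable_snd).
by apply/funext => z; rewrite /= tnth_mktuple.
Qed.

Lemma measurable_tsubr n (x : n.-tuple T) :
  measurable_fun [set: n.-tuple T] (tsub x).
Proof.
have mp := measurable_fun_pair (@measurable_cst _ _ _ _ setT x) (@measurable_id _ (n.-tuple T) setT).
exact: (measurableT_comp (@measurable_tsub n) mp).
Qed.

Lemma tsub_tcons n (a b : T) (t s : n.-tuple T) :
  tsub (tcons (a, t)) (tcons (b, s)) = tcons ((a - b)%R, tsub t s).
Proof.
apply: eq_from_tnth => i; rewrite tnth_mktuple.
by have [j ->|->] := unliftP ord0 i; rewrite ?tnthS ?tnth0 ?tnth_mktuple.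
Qed.

Lemma ge0_integral_tcons n (f : n.+1.-tuple T -> \bar R) :
  measurable_fun setT f -> (forall x, 0 <= f x) ->
  \int[borel_lebesgue R n.+1]_x f x =
  \int[lambda]_a \int[borel_lebesgue R n]_t f (tcons (a, t)).
Proof.
move=> mf f0.
rewrite (ge0_integral_pushforward (@measurable_tcons R n) (lambda \x borel_lebesgue R n)
  measurableT mf)//.
rewrite (fubini_tonelli1 (f \o @tcons R n))// => [|z]; last exact: f0.
by apply: measurableT_comp => //; exact: measurable_tcons.
Qed.

Lemma measurable_comp_tcons n (f : n.+1.-tuple T -> \bar R) :
  measurable_fun setT f -> measurable_fun [set: T * n.-tuple T] (f \o @tcons R n).
Proof. by move=> mf; apply: measurableT_comp => //; exact: measurable_tcons. Qed.

Lemma measurable_tcons_section n (f : n.+1.-tuple T -> \bar R) (a : T) :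
  measurable_fun setT f -> measurable_fun setT (fun t => f (tcons (a, t))).
Proof.
by move=> mf; exact: (measurableT_comp (measurable_comp_tcons mf)).
Qed.

Lemma measurable_pnorm_tcons n (f : n.+1.-tuple T -> \bar R) (r : R) :
  measurable_fun setT f ->
  measurable_fun setT (fun a => pnorm (borel_lebesgue R n) r (fun t => f (tcons (a, t)))).
Proof.
move=> mf; apply: measurable_poweR_comp.
apply: (measurable_fun_fubini_tonelli_F (fun z : T * n.-tuple T => f (tcons z) `^ r)).
  by apply: measurable_poweR_comp; exact: measurable_comp_tcons.
by move=> z; exact: poweR_ge0.
Qed.

Lemma pnorm_tcons n (f : n.+1.-tuple T -> \bar R) (r : R) : (0 < r)%R ->
  measurable_fun setT f -> (forall x, 0 <= f x) ->
  pnorm (borel_lebesgue R n.+1) r f =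
  pnorm lambda r (fun a => pnorm (borel_lebesgue R n) r (fun t => f (tcons (a, t)))).
Proof.
move=> r0 mf f0; congr (_ `^ _).
rewrite ge0_integral_tcons//.
- by apply: eq_integral => a _; rewrite poweR_pnorm// gt_eqF.
- exact: measurable_poweR_comp.
- by move=> x; exact: poweR_ge0.
Qed.

Definition tconv n (f g : n.-tuple T -> \bar R) (x : n.-tuple T) : \bar R :=
  \int[borel_lebesgue R n]_y (f (tsub x y) * g y).

Section tconv.
Variables (n : nat) (f g : n.-tuple T -> \bar R).
Hypotheses (mf : measurable_fun setT f) (mg : measurable_fun setT g).
Hypotheses (f0 : forall x, 0 <= f x) (g0 : forall x, 0 <= g x).

Lemma tconv_ge0 x : 0 <= tconv f g x.
Proof. by apply: integral_ge0 => y _; exact: mule_ge0. Qed.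

Lemma measurable_tconv : measurable_fun setT (tconv f g).
Proof.
apply: (measurable_fun_fubini_tonelli_F
  (fun z : n.-tuple T * n.-tuple T => f (tsub z.1 z.2) * g z.2)).
  apply: emeasurable_funM; first exact: (measurableT_comp mf (@measurable_tsub n)).
  exact: (measurableT_comp mg).
by move=> z; exact: mule_ge0.
Qed.

End tconv.

Section tensorization.
Variables (n : nat) (f g : n.+1.-tuple T -> \bar R).
Hypotheses (mf : measurable_fun setT f) (mg : measurable_fun setT g).
Hypotheses (f0 : forall x, 0 <= f x) (g0 : forall x, 0 <= g x).

Let f_ a t := f (tcons (a, t)).
Let g_ a t := g (tcons (a, t)).

(* Here [z = (t, b)]: the convolution over the last coordinates is evaluated at
   [t], and [b] is the first coordinate of the integration variable. *)
Let h (a : T) (z : n.-tuple T * T) := tconv (f_ (a - z.2)%R) (g_ z.2) z.1.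

Local Lemma measurable_slice a : measurable_fun setT (h a).
Proof.
pose k (z : (n.-tuple T * T) * n.-tuple T) :=
  f (tcons ((a - z.1.2)%R, tsub z.1.1 z.2)) * g (tcons (z.1.2, z.2)).
have m12 : measurable_fun setT (fun z : (n.-tuple T * T) * n.-tuple T => z.1.2).
  exact: (measurableT_comp measurable_snd measurable_fst).
have m11 : measurable_fun setT (fun z : (n.-tuple T * T) * n.-tuple T => z.1.1).
  exact: (measurableT_comp measurable_fst measurable_fst).
apply: (measurable_fun_fubini_tonelli_F k); last by move=> z; exact: mule_ge0.
apply: emeasurable_funM.
  apply: (measurableT_comp (measurable_comp_tcons mf)).
  apply: measurable_fun_pair; first exact: measurable_funB.
  exact: (measurableT_comp (@measurable_tsub n) (measurable_fun_pair m11 measurable_snd)).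
apply: (measurableT_comp (measurable_comp_tcons mg)).
exact: measurable_fun_pair.
Qed.

Local Lemma slice_ge0 a z : 0 <= h a z.
Proof. by apply: tconv_ge0 => t; [exact: f0|exact: g0]. Qed.

Lemma tconv_tcons a t :
  tconv f g (tcons (a, t)) = \int[lambda]_b h a (t, b).
Proof.
rewrite /tconv ge0_integral_tcons.
- apply: eq_integral => b _; apply: eq_integral => s _.
  by rewrite tsub_tcons.
- apply: emeasurable_funM; last exact: mg.
  exact: (measurableT_comp mf (measurable_tsubr _)).
- by move=> y; exact: mule_ge0.
Qed.

Variables (p q r : R).
Hypotheses (p0 : (0 < p)%R) (q0 : (0 < q)%R) (r0 : (0 < r)%R).

Let F a := pnorm (borel_lebesgue R n) p (f_ a).
Let G a := pnorm (borel_lebesgue R n) q (g_ a).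

Local Lemma mF : measurable_fun setT F.
Proof. exact: measurable_pnorm_tcons. Qed.

Local Lemma mG : measurable_fun setT G.
Proof. exact: measurable_pnorm_tcons. Qed.

Local Lemma F0 a : 0 <= F a. Proof. exact: pnorm_ge0. Qed.

Local Lemma G0 a : 0 <= G a. Proof. exact: pnorm_ge0. Qed.

Local Lemma measurable_lconv_section (a : T) :
  measurable_fun setT (fun b : T => F (a - b)%R * G b).
Proof.
apply: emeasurable_funM; last exact: mG.
by apply: (measurableT_comp mF); exact: measurable_funB.
Qed.

Local Lemma pnorm_tconv_tcons :
  pnorm (borel_lebesgue R n.+1) r (tconv f g) =
  pnorm lambda r (fun a => pnorm (borel_lebesgue R n) r (fun t => \int[lambda]_b h a (t, b))).
Proof.
apply: (etrans (pnorm_tcons r0 (measurable_tconv mf mg f0 g0) (tconv_ge0 f0 g0))).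
apply: (congr1 (pnorm lambda r)); apply/funext => a.
apply: (congr1 (pnorm (borel_lebesgue R n) r)); apply/funext => t.
exact: tconv_tcons.
Qed.

Local Lemma measurable_pnorm_slice : measurable_fun setT
  (fun a => pnorm (borel_lebesgue R n) r (fun t => \int[lambda]_b h a (t, b))).
Proof.
have := measurable_pnorm_tcons r (measurable_tconv mf mg f0 g0).
under eq_fun do under eq_fun do rewrite tconv_tcons.
by [].
Qed.

(** For fixed first coordinate [a] the convolution is an integral over [b] of convolutions of
    slices. Minkowski in the other coordinates moves the norm inside; each slice is then bounded by
    [C * (F (a - b) * G b)], whose integral in [b] is [C] times the convolution of [F] and [G] at
    [a]. *)
Lemma pnorm_tconv_le (C : \bar R) : 0 <= C -> (1 <= r)%R ->
  (forall a b, pnorm (borel_lebesgue R n) r (tconv (f_ a) (g_ b)) <= C * (F a * G b)) ->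
  pnorm (borel_lebesgue R n.+1) r (tconv f g) <= C * pnorm lambda r (lconv F G).
Proof.
move=> C0 r1 H; rewrite pnorm_tconv_tcons.
have mL : measurable_fun setT (lconv F G).
  by apply: measurable_lconv; [exact: mF|exact: mG|exact: F0|exact: G0].
have L0 x : 0 <= lconv F G x by apply: lconv_ge0; [exact: F0|exact: G0].
rewrite -pnormZ//; apply: pnorm_le => //.
- exact: measurable_pnorm_slice.
- exact: emeasurable_funM.
- by move=> a; exact: pnorm_ge0.
move=> a; apply: le_trans (minkowski_integral _ _ (measurable_slice a) (slice_ge0 a) r1) _.
rewrite /lconv -ge0_integralZl//; last 2 first.
- exact: measurable_lconv_section.
- by move=> b _; rewrite mule_ge0 ?F0 ?G0.
apply: ge0_le_integral => //.
- by move=> b _; exact: pnorm_ge0.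
- exact: (measurable_pnorm_section _ (measurable_slice a)).
- by apply: emeasurable_funM => //; exact: measurable_lconv_section.
- by move=> b _; exact: (H (a - b)%R b).
Qed.

Lemma pnorm_tconv_ge (C : \bar R) : 0 <= C -> (r <= 1)%R ->
  (forall a b, C * (F a * G b) <= pnorm (borel_lebesgue R n) r (tconv (f_ a) (g_ b))) ->
  C * pnorm lambda r (lconv F G) <= pnorm (borel_lebesgue R n.+1) r (tconv f g).
Proof.
move=> C0 r1 H; rewrite pnorm_tconv_tcons.
have mL : measurable_fun setT (lconv F G).
  by apply: measurable_lconv; [exact: mF|exact: mG|exact: F0|exact: G0].
have L0 x : 0 <= lconv F G x by apply: lconv_ge0; [exact: F0|exact: G0].
rewrite -pnormZ//; apply: pnorm_le => //.
- exact: emeasurable_funM.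
- exact: measurable_pnorm_slice.
- by move=> a; exact: mule_ge0.
have r01 : (0 < r <= 1)%R by rewrite r0.
move=> a; apply: le_trans (minkowski_integral_reverse _ _ (measurable_slice a) (slice_ge0 a) r01).
rewrite /lconv -ge0_integralZl//; last 2 first.
- exact: measurable_lconv_section.
- by move=> b _; rewrite mule_ge0 ?F0 ?G0.
apply: ge0_le_integral => //.
- by move=> b _; rewrite mule_ge0// mule_ge0 ?F0 ?G0.
- by apply: emeasurable_funM => //; exact: measurable_lconv_section.
- exact: (measurable_pnorm_section _ (measurable_slice a)).
Qed.

End tensorization.

Lemma pnorm_tuple0 (f : 0.-tuple T -> \bar R) (r : R) : (0 < r)%R ->
  measurable_fun setT f -> (forall x, 0 <= f x) ->
  pnorm (borel_lebesgue R 0) r f = f [tuple].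
Proof.
move=> r0 mf f0; rewrite /pnorm /= integral_dirac//.
  by rewrite diracT mul1e poweR_invK.
exact: measurable_poweR_comp.
Qed.

(** Slices contribute the constant to the power [n] by induction, and the functions [F], [G] of
    slice norms contribute one more factor by [young1]. In dimension [0] the measure is a point mass
    and the two sides agree. *)
Lemma young_tuple (p q r : R) (n : nat) (f g : n.-tuple T -> \bar R) :
  (0 < p)%R -> (0 < q)%R -> (0 < r)%R -> (p^-1 + q^-1 = 1 + r^-1)%R ->
  measurable_fun setT f -> measurable_fun setT g ->
  (forall x, 0 <= f x) -> (forall x, 0 <= g x) ->
  let mu := borel_lebesgue R n in
  let K := ((young_const p * young_const q / young_const r) ^+ n)%R in
  ((1 <= p)%R -> (1 <= q)%R -> (1 <= r)%R ->
    pnorm mu r (tconv f g) <= K%:E * pnorm mu p f * pnorm mu q g) /\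
  ((p <= 1)%R -> (q <= 1)%R -> (r <= 1)%R ->
    K%:E * pnorm mu p f * pnorm mu q g <= pnorm mu r (tconv f g)).
Proof.
move=> p0 q0 r0 pqr; elim: n f g => [|n IH] f g mf mg f0 g0 /=.
  rewrite expr0 mul1e !pnorm_tuple0//; last 2 first.
  - exact: measurable_tconv.
  - by move=> x; exact: tconv_ge0.
  have -> : tconv f g [tuple] = f [tuple] * g [tuple].
    rewrite /tconv /= integral_dirac//.
      by rewrite diracT mul1e (tuple0 (tsub _ _)).
    apply: emeasurable_funM; last exact: mg.
    exact: (measurableT_comp mf (measurable_tsubr _)).
  by split=> *.
pose K := (young_const p * young_const q / young_const r)%R.
have K0 k : 0 <= (K ^+ k)%:E.
  by rewrite lee_fin exprn_ge0// divr_ge0 ?mulr_ge0// ltW ?young_const_gt0.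
rewrite -/K; pose F a := pnorm (borel_lebesgue R n) p (fun t => f (tcons (a, t))).
pose G a := pnorm (borel_lebesgue R n) q (fun t => g (tcons (a, t))).
have mF : measurable_fun setT F by exact: measurable_pnorm_tcons.
have mG : measurable_fun setT G by exact: measurable_pnorm_tcons.
have [le1 ge1] := young1 p0 q0 r0 pqr mF mG (fun=> pnorm_ge0 _ _ _) (fun=> pnorm_ge0 _ _ _).
have KE : (K ^+ n.+1)%:E * pnorm (borel_lebesgue R n.+1) p f *
    pnorm (borel_lebesgue R n.+1) q g =
    (K ^+ n)%:E * (K%:E * pnorm lambda p F * pnorm lambda q G).
  rewrite (pnorm_tcons p0 mf f0) (pnorm_tcons q0 mg g0).
  by rewrite exprSr EFinM !muleA.
rewrite KE.
have slice a b := IH (fun t => f (tcons (a, t))) (fun t => g (tcons (b, t)))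
  (measurable_tcons_section a mf) (measurable_tcons_section b mg)
  (fun=> f0 _) (fun=> g0 _).
split=> p1 q1 r1.
  apply: le_trans (pnorm_tconv_le (p := p) (q := q) mf mg f0 g0 r0 (K0 n) r1 _) _.
    by move=> a b; rewrite muleA; case: (slice a b) => + _; exact.
  by apply: lee_wpmul2l => //; exact: le1.
apply: le_trans (pnorm_tconv_ge (p := p) (q := q) mf mg f0 g0 r0 (K0 n) r1 _).
  by apply: lee_wpmul2l => //; exact: ge1.
by move=> a b; rewrite muleA; case: (slice a b) => _; exact.
Qed.

End tuples.

(** * Borel versions of Lebesgue measurable functions *)

Section outer_measure_approximation.
Context d (T : measurableType d) (R : realType).
Variable mu : {sigma_finite_measure set T -> \bar R}.
Local Open Scope ereal_scope.

(** Intersection over [n] of countable measurable covers whose total measure exceeds the outer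
    measure by less than [1/(n+1)]; the whole space if the outer measure is infinite. *)
Lemma outer_hull (X : set T) :
  exists G, [/\ measurable G, X `<=` G & mu G <= (mu^*)%mu X].
Proof.
have [Xoo|Xoo] := eqVneq ((mu^*)%mu X) +oo.
  by exists setT; split => //; rewrite Xoo leey.
have Xfin : (mu^*)%mu X \is a fin_num.
  by rewrite ge0_fin_numE ?ltey// mu_ext_ge0.
have cov n : exists2 F, measurable_cover X F &
    \sum_(0 <= k <oo) mu (F k) < (mu^*)%mu X + n.+1%:R^-1%:E.
  have n0 : (0 < n.+1%:R^-1 :> R)%R by rewrite invr_gt0.
  by have [_ [F XF <-] ?] := lb_ereal_inf_adherent n0 Xfin; exists F.
have {cov}[F FP] := choice (fun n => let: ex_intro2 F h1 h2 := cov n in ex_intro _ F (conj h1 h2)).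
have mF n : measurable (\bigcup_k F n k).
  by apply: bigcupT_measurable => k; exact: (FP n).1.1.
exists (\bigcap_n \bigcup_k F n k); split.
- exact: bigcapT_measurable.
- by move=> x Xx n _; exact: (FP n).1.2.
- apply/lee_addgt0Pr => _/posnumP[e]; near \oo => n.
  apply: (@le_trans _ _ (mu (\bigcup_k F n k))).
    apply: le_measure; rewrite ?inE//; first exact: bigcapT_measurable.
    exact: bigcap_inf.
  apply: (@le_trans _ _ (\sum_(0 <= k <oo) mu (F n k))).
    apply: measure_sigma_subadditive => //; exact: (FP n).1.1.
  apply: (le_trans (ltW (FP n).2)); rewrite leeD// lee_fin ltW//.
  by near: n; apply: near_infty_natSinv_lt.
Unshelve. all: by end_near. Qed.

(** [A] is cut along sets [F k] of finite measure, so that Caratheodory's identity on the hull [H k]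
    can be solved for the outer measure of the difference, which is then [0]. Countably many null
    differences remain. *)
Lemma caratheodory_hull (A : set T) : caratheodory_measurable (mu^*)%mu A ->
  exists B, [/\ measurable B, A `<=` B & mu.-negligible (B `\` A)].
Proof.
move=> cA; have [F TF Foo] := sigma_finiteT mu.
have [H HP] := choice (fun k => outer_hull (A `&` F k)).
exists (\bigcup_k H k); split.
- by apply: bigcupT_measurable => k; have [] := HP k.
- move=> x Ax; have : setT x by [].
  by rewrite TF => -[k _ Fx]; exists k => //; have [_ + _] := HP k; exact.
apply: (@negligibleS _ _ _ _ (\bigcup_k (H k `\` (A `&` F k)))).
  by move=> x [[k _ Hx] nAx]; exists k => //; split => // -[].
apply: negligible_bigcup => k; have [mH AFH muH] := HP k.
have [mFk Fkoo] := Foo k.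
have cAF : caratheodory_measurable (mu^*)%mu (A `&` F k).
  apply: caratheodory_measurable_setI => //.
  exact: caratheodory_measurable_mu_ext.
have := cAF (H k); rewrite setIidr// measurable_mu_extE// => HE.
have AFoo : (mu^*)%mu (A `&` F k) \is a fin_num.
  rewrite ge0_fin_numE ?mu_ext_ge0//; apply: le_lt_trans Fkoo.
  by rewrite -[leRHS]measurable_mu_extE//; apply: le_mu_ext; exact: subIsetr.
have D0 : (mu^*)%mu (H k `&` ~` (A `&` F k)) <= 0.
  by move: muH; rewrite HE -leeBrDl// subee.
have [Z [mZ DZ Z0]] := outer_hull (H k `&` ~` (A `&` F k)).
exists Z; split => //; apply/eqP; rewrite -measure_le0.
exact: le_trans D0.
Qed.

End outer_measure_approximation.

Section measurable_version.
Context d (T : measurableType d) (R : realType).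
Variable mu : {sigma_finite_measure set T -> \bar R}.
Local Open Scope ereal_scope.

(** [f x] is the supremum of the rationals below it. Each set where [f] exceeds a rational is
    replaced by a measurable hull, and outside the countable union of the null differences nothing
    changes. *)
Lemma caratheodory_measurable_version (f : T -> R) :
  (forall q : R, caratheodory_measurable (mu^*)%mu [set x | q < f x]%R) ->
  (forall x, 0 <= f x)%R ->
  exists phi : T -> \bar R, [/\ measurable_fun setT phi,
    forall x, 0 <= phi x & {ae mu, forall x, phi x = (f x)%:E}].
Proof.
move=> mf f0.
(* An enumeration of the rationals; indices that code no rational repeat the value [0]. *)
pose q k : R := ratr (odflt 0%R (unpickle k)).
have [B BP] := choice (fun k => caratheodory_hull (mf (q k))).
pose u k x := (Num.max (q k) 0 * \1_(B k) x)%:E.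
have u0 k x : 0 <= u k x by rewrite lee_fin mulr_ge0// le_max lexx orbT.
exists (fun x => esups (u ^~ x) 0%N); split.
- apply: measurable_fun_esups => k; apply/measurable_EFinP.
  apply: measurable_funM => //; apply: measurable_indic.
  by have [] := BP k.
- by move=> x; apply: (le_trans (u0 0%N x)); apply: ereal_sup_ubound; exists 0%N.
- apply: (@negligibleS _ _ _ _ (\bigcup_k (B k `\` [set x | q k < f x]%R))); last first.
    by apply: negligible_bigcup => k; have [] := BP k.
  move=> x /= nE; apply: contrapT => nB; apply: nE.
  apply/eqP; rewrite eq_le; apply/andP; split.
    apply: ge_ereal_sup => _ [k _ <-]; rewrite lee_fin indicE.
    have [Bx|_] := boolP (x \in B k); last by rewrite mulr0.
    rewrite mulr1 ge_max f0 andbT leNgt; apply/negP => fq; apply: nB; exists k => //.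
    by split; [exact: set_mem|rewrite /= => /(lt_trans fq); rewrite ltxx].
  apply/lee_subgt0Pr => e e0.
  have /rat_in_itvoo[s] : (f x - e < f x)%R by rewrite ltrBlDr ltrDl.
  rewrite in_itv/= => /andP[es sf].
  have qs : q (pickle s) = ratr s by rewrite /q pickleK.
  apply: (@le_trans _ _ (u (pickle s) x)); last by apply: ereal_sup_ubound; exists (pickle s).
  rewrite lee_fin indicE mem_set ?mulr1 ?le_max ?qs ?(ltW es)//.
  by have [_ + _] := BP (pickle s); apply; rewrite /= qs.
Qed.

End measurable_version.

Section tuple_reflection.
Context (R : realType).
Local Notation T := (measurableTypeR R).
Local Notation lambda := (@lebesgue_measure R).
Local Open Scope ereal_scope.

(** Coordinate by coordinate, from the reflection [b -> a - b] of the line. It is needed to keep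
    null sets null under [y -> x - y]. *)
Lemma ge0_integral_tsub n (x : n.-tuple T) (f : n.-tuple T -> \bar R) :
  measurable_fun setT f -> (forall y, 0 <= f y) ->
  \int[borel_lebesgue R n]_y f (tsub x y) = \int[borel_lebesgue R n]_y f y.
Proof.
elim: n => [|n IH] in x f * => mf f0.
  by apply: eq_integral => y _; rewrite [tsub x y]tuple0 [y]tuple0.
case/tupleP: x => a t; rewrite -[[tuple of _]]/(tcons (a, t)).
rewrite [RHS]ge0_integral_tcons//.
rewrite (ge0_integral_tcons (f := fun y => f (tsub (tcons (a, t)) y)))//; last first.
  exact: (measurableT_comp mf (@measurable_tsubr _ _ _)).
transitivity (\int[lambda]_b \int[borel_lebesgue R n]_s f (tcons ((a - b)%R, s))).
  apply: eq_integral => b _.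
  rewrite -(IH t (fun s => f (tcons ((a - b)%R, s))))//.
    by apply: eq_integral => s _; rewrite tsub_tcons.
  exact: measurable_tcons_section.
apply: (@ge0_integral_reflect _ (fun b => \int[borel_lebesgue R n]_s f (tcons (b, s)))).
  apply: (@measurable_fun_fubini_tonelli_F _ _ _ _ _ (borel_lebesgue R n) (f \o @tcons R n)).
    exact: measurable_comp_tcons.
  by move=> z; exact: f0.
by move=> b; apply: integral_ge0 => s _; exact: f0.
Qed.

Lemma ae_tsub n (x : n.-tuple T) (P : set (n.-tuple T)) :
  {ae borel_lebesgue R n, forall y, P y} ->
  {ae borel_lebesgue R n, forall y, P (tsub x y)}.
Proof.
move=> [Z [mZ Z0 PZ]].
have mS : measurable (tsub x @^-1` Z).
  by rewrite -[_ @^-1` _]setTI; apply: measurable_tsubr.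
exists (tsub x @^-1` Z); split => //; last by move=> y nP; exact: PZ.
rewrite -(setIT (tsub x @^-1` Z)) -integral_indic//.
rewrite (ge0_integral_tsub x (f := fun y => (\1_Z y)%:E))//.
- by rewrite integral_indic// setIT.
- by apply/measurable_EFinP; exact: measurable_indic.
Qed.

End tuple_reflection.

(** * From Borel tuples to the complete Lebesgue measure *)

Section lebesgueN_borel.
Context (R : realType) (n : nat).
Local Notation T := (measurableTypeR R).
Local Notation E := (euclidean R n).
Local Notation mu := (borel_lebesgue R n).
Local Notation nu := (@lebesgueN R n).
Local Open Scope ereal_scope.

Lemma measurable_euclidean_id :
  measurable_fun [set: E] (fun x : E => x : n.-tuple T).
Proof.
move=> _ Y mY; rewrite setTI; exact: caratheodory_measurable_mu_ext.
Qed.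

Lemma measurable_fun_euclidean d (U : measurableType d) (f : n.-tuple T -> U) :
  measurable_fun setT f -> measurable_fun [set: E] (f : E -> U).
Proof. by move=> mf; exact: (measurableT_comp mf measurable_euclidean_id). Qed.

(** The identity from [euclidean] to tuples is measurable and pushes [lebesgueN] forward to
    [borel_lebesgue], since the two agree on Borel sets. *)
Lemma ge0_integral_lebesgueN (f : n.-tuple T -> \bar R) :
  measurable_fun setT f -> (forall x, 0 <= f x) ->
  \int[nu]_x f x = \int[mu]_x f x.
Proof.
move=> mf f0.
have := ge0_integral_pushforward measurable_euclidean_id nu measurableT mf.
rewrite preimage_setT => <-; last by move=> x _; exact: f0.
apply: eq_measure_integral; first exact: measurable_euclidean_id.
by move=> mid A mA _; exact: (measurable_mu_extE mu).
Qed.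

Lemma ae_lebesgueN (P : set (n.-tuple T)) :
  {ae mu, forall x, P x} -> {ae nu, forall x, P x}.
Proof.
move=> [Z [mZ Z0 PZ]]; exists Z; split => //.
  exact: caratheodory_measurable_mu_ext.
by rewrite -Z0; exact: measurable_mu_extE.
Qed.

Lemma lebesgueN_complete : measure_is_complete nu.
Proof. exact: measure_is_complete_caratheodory. Qed.

(** Measurability of [f] comes from completeness of [lebesgueN], as [f] agrees almost everywhere
    with the measurable [phi]. *)
Lemma ge0_integral_lebesgueN_ae (f : E -> \bar R) (phi : n.-tuple T -> \bar R) :
  measurable_fun setT phi -> (forall x, 0 <= phi x) -> (forall x, 0 <= f x) ->
  {ae mu, forall x, phi x = f x} ->
  \int[nu]_x f x = \int[mu]_x phi x.
Proof.
move=> mphi phi0 f0 /ae_lebesgueN phif; rewrite -ge0_integral_lebesgueN//.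
have mphiE := measurable_fun_euclidean mphi.
have eq : ae_eq nu setT (phi : E -> \bar R) f.
  by apply: ae_imply phif => x + _.
apply/esym/ge0_ae_eq_integral => //.
exact: (ae_measurable_fun lebesgueN_complete eq).
Qed.

Lemma Lnorm_lebesgueN (r : R) (f : E -> \bar R) (phi : n.-tuple T -> \bar R) :
  measurable_fun setT phi -> (forall x, 0 <= phi x) -> (forall x, 0 <= f x) ->
  {ae mu, forall x, phi x = f x} ->
  'N[nu]_r%:E [f] = pnorm mu r phi.
Proof.
move=> mphi phi0 f0 phif; rewrite Lnorm_pnorm//; congr (_ `^ _).
apply: ge0_integral_lebesgueN_ae => //.
- exact: measurable_poweR_comp.
- by move=> x; exact: poweR_ge0.
- by move=> x; exact: poweR_ge0.
- by apply: ae_imply phif => x ->.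
Qed.

Lemma measurable_version (f : E -> R) : measurable_fun setT f ->
  (forall x, 0 <= f x)%R ->
  exists phi : n.-tuple T -> \bar R, [/\ measurable_fun setT phi,
    forall x, 0 <= phi x & {ae mu, forall x, phi x = (f x)%:E}].
Proof.
move=> mf f0; apply: caratheodory_measurable_version => // q.
have := mf measurableT _ (measurable_itv `]q, +oo[).
by rewrite setTI preimage_itvoy.
Qed.

(** Equality holds at every point: for fixed [x], the [y] at which [phi] and [f] differ in [x - y]
    form the reflection of a null set. *)
Lemma convolution_version (f g : E -> R) (phi psi : n.-tuple T -> \bar R) :
  (forall x, 0 <= f x)%R -> (forall x, 0 <= g x)%R ->
  measurable_fun setT phi -> measurable_fun setT psi ->
  (forall x, 0 <= phi x) -> (forall x, 0 <= psi x) ->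
  {ae mu, forall x, phi x = (f x)%:E} -> {ae mu, forall x, psi x = (g x)%:E} ->
  convolution f g = tconv phi psi.
Proof.
move=> f0 g0 mphi mpsi phi0 psi0 phif psig; apply/funext => x.
apply: ge0_integral_lebesgueN_ae.
- apply: emeasurable_funM => //.
  exact: (measurableT_comp mphi (@measurable_tsubr _ _ x)).
- by move=> y; exact: mule_ge0.
- by move=> y; rewrite lee_fin mulr_ge0.
- by apply: ae_imply2 (ae_tsub x phif) psig => y /= -> ->; rewrite EFinM.
Qed.

End lebesgueN_borel.

Theorem theorem1 (R : realType) (N : nat) (p q r : R)
    (f g : euclidean R N -> R) :
  (1 <= N)%N ->
  0 < p -> 0 < q -> 0 < r ->
  p^-1 + q^-1 = 1 + r^-1 ->
  f \in Lfun (lebesgueN R N) p%:E ->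
  g \in Lfun (lebesgueN R N) q%:E ->
  (forall x, 0 <= f x) -> (forall x, 0 <= g x) ->
  let K := (young_const p * young_const q / young_const r) ^+ N in
  (1 <= p -> 1 <= q -> 1 <= r ->
    ('N[lebesgueN R N]_(r%:E) [convolution f g]
     <= K%:E * 'N[lebesgueN R N]_(p%:E) [EFin \o f]
             * 'N[lebesgueN R N]_(q%:E) [EFin \o g])%E) /\
  (p <= 1 -> q <= 1 -> r <= 1 ->
    (K%:E * 'N[lebesgueN R N]_(p%:E) [EFin \o f]
          * 'N[lebesgueN R N]_(q%:E) [EFin \o g]
     <= 'N[lebesgueN R N]_(r%:E) [convolution f g])%E).
Proof.
move=> _ p0 q0 r0 pqr fp gq f0 g0 K.
have mfun_Lfun (s : R) (h : euclidean R N -> R) :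
    h \in Lfun (lebesgueN R N) s%:E -> measurable_fun setT h.
  by move=> /sub_Lfun_mfun; rewrite inE.
have [phi [mphi phi0 phif]] := measurable_version (mfun_Lfun _ _ fp) f0.
have [psi [mpsi psi0 psig]] := measurable_version (mfun_Lfun _ _ gq) g0.
rewrite (Lnorm_lebesgueN p mphi phi0 _ phif); last by move=> x; rewrite lee_fin.
rewrite (Lnorm_lebesgueN q mpsi psi0 _ psig); last by move=> x; rewrite lee_fin.
rewrite (convolution_version f0 g0 mphi mpsi phi0 psi0 phif psig).
have c0 x : (0 <= tconv phi psi x)%E by exact: tconv_ge0.
have mc := measurable_tconv mphi mpsi phi0 psi0.
(* The convolution is now a Borel function and serves as its own version. *)
rewrite (Lnorm_lebesgueN r mc c0 c0); last exact: ae_all.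
exact: young_tuple.
Qed.
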